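(* Let $k$ be a field. Every regular graded $k$-algebra $A$ of global dimension $2$ is graded coherent.
   Context: A graded algebra is an $\mathbb N$-graded associative $k$-algebra $A=A_0\oplus A_1\oplus\cdots$ which is connected ($A_0=k$) and finitely generated (not necessarily in degree one). All modules are $\mathbb Z$-graded and all elements and maps are homogeneous. A graded algebra $A$ is called regular if it has finite global dimension $d$ and satisfies the Gorenstein property: $\operatorname{Ext}^i_A(k_A,A_A)=0$ for $i\neq d$ and $\operatorname{Ext}^d_A(k_A,A_A)\cong k[l]$ for some $l\in\mathbb Z$, where $[l]$ denotes a shift of grading. No growth condition is imposed. The algebra $A$ is called graded coherent (meaning graded right coherent) if every finitely generated homogeneous right ideal of $A$ is finitely presented as a right $A$-module. *)

(* Defs.v *)
From HB Require Import structures.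
From mathcomp Require Import all_boot all_order all_algebra boolp.

Set Implicit Arguments.
Unset Strict Implicit.
Unset Printing Implicit Defensive.

Import GRing.Theory.
Local Open Scope ring_scope.

(* The zmodule V is the internal direct sum of its subgroups S i. *)
Definition direct_sum (I : eqType) (V : zmodType) (S : I -> V -> Prop) : Prop :=
  [/\ forall i, S i 0 /\ (forall x y, S i x -> S i y -> S i (x - y)),
      forall x, exists (s : seq I) (f : I -> V),
        (forall i, S i (f i)) /\ x = \sum_(i <- s) f i
    & forall (s : seq I) (f : I -> V), uniq s -> (forall i, S i (f i)) ->
        \sum_(i <- s) f i = 0 -> forall i, i \in s -> f i = 0].

(* Connected N-graded finitely generated k-algebras.  Closure of each A_i under
   k-scaling follows from [gr_mul] and [gr_connected]. *)
Record gralg (k : fieldType) := GrAlg {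
  galg :> algType k;
  gr : nat -> galg -> Prop;
  gr_direct : direct_sum gr;
  gr_mul : forall i j x y, gr i x -> gr j y -> gr (i + j)%N (x * y);
  gr_connected : forall x, gr 0%N x <-> exists c : k, x = c%:A;
  gr_fingen : exists s : seq galg, forall S : galg -> Prop,
    S 1 -> (forall (c : k) x y, S x -> S y -> S (c *: x + y)) ->
    (forall x y, S x -> S y -> S (x * y)) ->
    (forall x, x \in s -> S x) -> forall x, S x
}.

(* Right A-modules are left modules over the converse ring A^c; [x <* a] is the
   right action. *)
Definition ract (k : fieldType) (A : gralg k) (M : lmodType (galg A)^c)
  (x : M) (a : A) : M := @GRing.scale (galg A)^c M a x.
Notation "x <* a" := (ract x a) (at level 40, left associativity) : ring_scope.

Record gmod (k : fieldType) (A : gralg k) := GMod {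
  gcar :> lmodType (galg A)^c;
  gdeg : int -> gcar -> Prop;
  gdeg_direct : direct_sum gdeg;
  gdeg_act : forall i j x (a : A), gdeg i x -> gr j a ->
    gdeg (i + j%:Z) (x <* a)
}.

(* Carrier of k_A; A is a parameter so that the A-action can be inferred. *)
Definition triv (k : fieldType) (A : gralg k) : Type := k.
HB.instance Definition _ (k : fieldType) (A : gralg k) :=
  GRing.Zmodule.on (triv A).

Section Regular.
Variables (k : fieldType) (A : gralg k).

Definition reg_deg (i : int) (x : A) : Prop :=
  match i with Posz n => gr n x | Negz _ => x = 0 end.

Lemma reg_deg_direct : direct_sum (V := (galg A)^c^o) reg_deg.
Proof.
have [Sz Se Si] := gr_direct A.
split.
- case=> [n|n] /=; first exact: Sz.
  by split=> // x y -> ->; rewrite subrr.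
- move=> x; have [s [f [fS ->]]] := Se x.
  exists (map Posz s), (fun i => if i is Posz n then f n else 0).
  by split; [case | rewrite big_map].
- move=> s f us fS s0.
  have fN n : f (Negz n) = 0 by exact: (fS (Negz n)).
  pose t := pmap (fun i : int => if i is Posz n then Some n else None) s.
  have tP n : (n \in t) = (Posz n \in s).
    rewrite /t; elim: s {us s0 t} => //= -[m|m] s IH /=.
      by rewrite !inE IH.
    by rewrite inE IH.
  have ut : uniq t.
    rewrite /t; elim: s us {s0} @t tP => //= -[m|m] s IH /andP[ms us] tP /=.
      rewrite IH // ?andbT.
        have : forall n, n \in pmap (fun i : int => if i is Posz n then Some n
          else None) s -> Posz n \in s.
          elim: s {IH ms us tP} => //= -[p|p] s IH n /=.
            by rewrite !inE => /orP[/eqP->|/IH->]; rewrite ?eqxx ?orbT.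
          by rewrite inE => /IH->.
        by move=> H; apply/negP => /H; rewrite (negbTE ms).
      move=> n; elim: s {IH ms us tP} => //= -[p|p] s IH /=.
        by rewrite !inE IH.
      by rewrite inE IH.
    by apply: IH => // n; rewrite tP inE.
  have st : \sum_(n <- t) f (Posz n) = 0 :> A.
    rewrite -[RHS]s0 /t; elim: s {us s0 t tP ut} => /= [|[m|m] s IH] /=.
    + by rewrite !big_nil.
    + by rewrite !big_cons IH.
    + by rewrite big_cons IH fN add0r.
  move=> [n|n] ins; last exact: fN.
  apply: (Si t (fun n => f (Posz n))) => //; last by rewrite tP.
  by move=> i; exact: (fS (Posz i)).
Qed.

Lemma reg_deg_act i j (x : (galg A)^c^o) (a : A) :
  reg_deg i x -> gr j a -> reg_deg (i + j%:Z) (x <* a).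
Proof.
case: i => [n|n] /=; first exact: gr_mul.
move=> -> _; rewrite /ract scaler0; case: (_ + _) => //= m.
by have [Sz _ _] := gr_direct A; case: (Sz m).
Qed.

(* A_A *)
Definition reg_gmod : gmod A := GMod reg_deg_direct reg_deg_act.

(* The augmentation A -> A_0 = k, with kernel A_+. *)
Definition Aplus (x : A) : Prop := exists (n : nat) (f : nat -> A),
  (forall i, gr i.+1 (f i)) /\ x = \sum_(i < n) f i.

Lemma gr0 i : gr i (0 : A).
Proof. by have [Sz _ _] := gr_direct A; case: (Sz i). Qed.

Lemma grB i (x y : A) : gr i x -> gr i y -> gr i (x - y).
Proof. by have [Sz _ _] := gr_direct A; case: (Sz i) => _; apply. Qed.

Lemma grN i (x : A) : gr i x -> gr i (- x).
Proof. by move=> ?; rewrite -sub0r; apply: grB => //; exact: gr0. Qed.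

Lemma grD i (x y : A) : gr i x -> gr i y -> gr i (x + y).
Proof. by move=> ? ?; rewrite -[y]opprK; apply: grB => //; exact: grN. Qed.

Lemma Aplus_hom i x : gr i.+1 x -> Aplus x.
Proof.
move=> xi; exists i.+1, (fun j => if j == i then x else 0); split.
  by move=> j; case: eqP => [->//|_]; exact: gr0.
rewrite big_ord_recr /= eqxx big1 ?add0r // => j _.
by rewrite ltn_eqF.
Qed.

Lemma AplusD x y : Aplus x -> Aplus y -> Aplus (x + y).
Proof.
move=> [n [f [fS ->]]] [m [g [gS ->]]].
exists (n + m)%N, (fun i => (if (i < n)%N then f i else 0) +
                            (if (i < m)%N then g i else 0)); split.
  by move=> i; apply: grD; case: ifP => // _; exact: gr0.
rewrite big_split /=; congr (_ + _).
  rewrite big_split_ord /= [X in _ + X]big1 ?addr0.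
    by apply: eq_bigr => i _; rewrite ltn_ord.
  by move=> i _; rewrite ltnNge leq_addr.
rewrite addnC big_split_ord /= [X in _ + X]big1 ?addr0.
  by apply: eq_bigr => i _; rewrite ltn_ord.
by move=> i _; rewrite ltnNge leq_addr.
Qed.

Lemma Aplus0 : Aplus 0.
Proof. by exists 0%N, (fun=> 0); split; [move=> i; exact: gr0|rewrite big_ord0]. Qed.

Lemma Aplus_sum n (F : 'I_n -> A) :
  (forall i, Aplus (F i)) -> Aplus (\sum_i F i).
Proof.
by move=> FS; elim/big_rec: _ => [|i x _]; [exact: Aplus0|exact: AplusD].
Qed.

Lemma AplusM x y : Aplus x -> Aplus y -> Aplus (x * y).
Proof.
move=> [n [f [fS ->]]] [m [g [gS ->]]].
rewrite mulr_suml; apply: Aplus_sum => i.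
rewrite mulr_sumr; apply: Aplus_sum => j.
by apply: (@Aplus_hom (i + j.+1)); exact: (gr_mul (fS i) (gS j)).
Qed.

Lemma grZ i c (x : A) : gr i x -> gr i (c *: x).
Proof.
move=> xi; rewrite -mulr_algl -[i]add0n; apply: gr_mul => //.
by apply/gr_connected; exists c.
Qed.

Lemma AplusZ c x : Aplus x -> Aplus (c *: x).
Proof.
move=> [n [f [fS ->]]]; rewrite scaler_sumr; apply: Aplus_sum => i.
by apply: (@Aplus_hom i); exact: grZ.
Qed.

Lemma aug_ex x : exists c : k, Aplus (x - c%:A).
Proof.
have [_ Se _] := gr_direct A.
have [s [f [fS ->]]] := Se x.
elim: s => [|i s [c IH]]; first by exists 0; rewrite big_nil scale0r subr0; exact: Aplus0.
rewrite big_cons; case: i => [|i].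
  have /gr_connected[d ->] := fS 0%N.
  exists (d + c); rewrite scalerDl opprD addrACA subrr add0r; exact: IH.
exists c; rewrite -addrA; apply: AplusD => //.
exact: Aplus_hom (fS i.+1).
Qed.

Definition aug (x : A) : k := projT1 (cid (aug_ex x)).

Lemma augP x : Aplus (x - (aug x)%:A).
Proof. by rewrite /aug; case: cid. Qed.

Lemma Aplus_scalar c : Aplus c%:A -> c = 0.
Proof.
move=> [n [f [fS fE]]]; have [_ _ Si] := gr_direct A.
pose F i : A := if i is j.+1 then - f j else c%:A.
have FS i : gr i (F i).
  by case: i => [|i] /=; [apply/gr_connected; exists c|exact: grN].
have := Si (iota 0 n.+1) F (iota_uniq _ _) FS.
rewrite -[iota 0 n.+1]/(index_iota 0 n.+1) big_mkord big_ord_recl /= sumrN -fE subrr.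
move=> /(_ erefl 0%N); rewrite mem_iota /= => /(_ isT) /eqP.
by rewrite scaler_eq0 oner_eq0 orbF => /eqP.
Qed.

Lemma augE x c : Aplus (x - c%:A) -> aug x = c.
Proof.
move=> xc; have /AplusD/(_ (AplusZ (-1) (augP x))) := xc.
rewrite scaleN1r opprB addrC subrKA -scalerBl.
by move=> /Aplus_scalar/eqP; rewrite subr_eq0 => /eqP.
Qed.

Lemma augD x y : aug (x + y) = aug x + aug y.
Proof.
apply: augE; rewrite scalerDl opprD addrACA; apply: AplusD; exact: augP.
Qed.

Lemma aug1 : aug 1 = 1.
Proof. by apply: augE; rewrite scale1r subrr; exact: Aplus0. Qed.

Lemma augM x y : aug (x * y) = aug x * aug y.
Proof.
apply: augE.
have -> : x * y - (aug x * aug y)%:A =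
  (x - (aug x)%:A) * (y - (aug y)%:A)
  + aug x *: (y - (aug y)%:A) + aug y *: (x - (aug x)%:A).
  rewrite mulrBr mulr_algr addrAC subrK mulrBl mulr_algl scalerBr scalerA.
  by rewrite addrA subrK.
by apply: AplusD; [apply: AplusD; [apply: AplusM|]|]; try apply: AplusZ; exact: augP.
Qed.

Lemma aug_hom i x : gr i.+1 x -> aug x = 0.
Proof. by move=> xi; apply: augE; rewrite scale0r subr0; exact: Aplus_hom xi. Qed.

Definition triv_scale (a : (galg A)^c) (x : triv A) : triv A := (x : k) * aug a.

Fact triv_scaleA a b x : triv_scale a (triv_scale b x) = triv_scale (a * b) x.
Proof. by rewrite /triv_scale -mulrA -augM. Qed.
Fact triv_scale1 : left_id 1 triv_scale.
Proof. by move=> x; rewrite /triv_scale aug1 mulr1. Qed.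
Fact triv_scaleDr : right_distributive triv_scale +%R.
Proof. by move=> a x y; rewrite /triv_scale mulrDl. Qed.
Fact triv_scaleDl x : {morph triv_scale^~ x : a b / a + b}.
Proof. by move=> a b; rewrite /triv_scale augD mulrDr. Qed.

HB.instance Definition _ := GRing.Zmodule_isLmodule.Build (galg A)^c (triv A)
  triv_scaleA triv_scale1 triv_scaleDr triv_scaleDl.

Definition triv_deg (i : int) (x : triv A) : Prop := i != 0 -> x = 0.

Lemma triv_deg_direct : direct_sum triv_deg.
Proof.
split.
- by move=> i; split=> // x y xi yi /[dup]/xi-> /yi->; rewrite subrr.
- move=> x; exists [:: 0], (fun i => if i == 0 then x else 0); split.
    by move=> i /negbTE ->.
  by rewrite big_seq1 eqxx.
- move=> s f us fS s0 i ins; have [i0|] := eqVneq i 0; last exact: fS.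
  rewrite -s0 (bigD1_seq i) //= big1 ?addr0 // => j ji.
  by apply: fS; rewrite -i0.
Qed.

Lemma triv_deg_act i j (x : triv A) (a : A) :
  triv_deg i x -> gr j a -> triv_deg (i + j%:Z) (x <* a).
Proof.
move=> xi; case: j => [|j] aj; rewrite /triv_deg /ract.
  by rewrite addr0 => /xi->; rewrite scaler0.
by move=> _; rewrite /GRing.scale /= /triv_scale (aug_hom aj) mulr0.
Qed.

(* k_A *)
Definition triv_gmod : gmod A := GMod triv_deg_direct triv_deg_act.

(* Degree j elements of the graded Hom, i.e. morphisms M -> N[j]
   with N[j]_i = N_(i+j). *)
Definition deg_map (M N : gmod A) (j : int) (f : {linear M -> N}) : Prop :=
  forall i x, gdeg i x -> gdeg (i + j) (f x).

Definition projective (P : gmod A) : Prop :=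
  forall (M N : gmod A) (p : {linear M -> N}) (f : {linear P -> N}),
    deg_map 0 p -> (forall y, exists x, p x = y) -> deg_map 0 f ->
    exists2 g : {linear P -> M}, deg_map 0 g & forall x, p (g x) = f x.

Record resolution (M : gmod A) := Resolution {
  rmod :> nat -> gmod A;
  rdiff : forall n, {linear rmod n.+1 -> rmod n};
  raug : {linear rmod 0%N -> M};
  rproj : forall n, projective (rmod n);
  rdiff_deg : forall n, deg_map 0 (rdiff n);
  raug_deg : deg_map 0 raug;
  raug_surj : forall y, exists x, raug x = y;
  rexact0 : forall x, raug x = 0 <-> exists y, x = rdiff 0%N y;
  rexact : forall n x, rdiff n x = 0 <-> exists y, x = rdiff n.+1 y
}.

Definition pd_le (M : gmod A) (d : nat) : Prop :=
  exists R : resolution M, forall n, (d < n)%N -> forall x : R n, x = 0.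

Definition has_gldim (d : nat) : Prop :=
  (forall M : gmod A, pd_le M d) /\
  (forall d', (forall M : gmod A, pd_le M d') -> (d <= d')%N).

Section Ext.
Variables (M N : gmod A) (R : resolution M).

Definition cocycle (i : nat) (j : int) (f : {linear R i -> N}) : Prop :=
  deg_map j f /\ forall y, f (rdiff R i y) = 0.

Definition coboundary (i : nat) (j : int) : {linear R i -> N} -> Prop :=
  match i return {linear R i -> N} -> Prop with
  | 0 => fun f => forall x, f x = 0
  | n.+1 => fun f => exists2 g : {linear R n -> N},
      deg_map j g & forall x, f x = g (rdiff R n x)
  end.

(* H^i(Hom(R, N)) is isomorphic to E as a graded k-space: in each degree j there
   is a k-linear surjection of the cocycles onto E j whose kernel is the space of
   coboundaries.  Linear maps have no k-structure in the library because A is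
   noncommutative, so k-linear combinations are taken pointwise. *)
Definition cohomology_iso (i : nat) (E : int -> lmodType k) : Prop :=
  forall j, exists phi : {linear R i -> N} -> E j,
    [/\ forall (c : k) f g h, cocycle j f -> cocycle j g -> cocycle j h ->
          (forall x, h x = f x <* c%:A + g x) -> phi h = c *: phi f + phi g,
        forall e, exists2 f, cocycle j f & phi f = e
      & forall f, cocycle j f -> (phi f = 0 <-> coboundary j f)].

End Ext.

(* Ext^i_A(M, N), the derived functor of the graded Hom, is isomorphic to E.
   It does not depend on the projective resolution. *)
Definition Ext_iso (i : nat) (M N : gmod A) (E : int -> lmodType k) : Prop :=
  forall R : resolution M, cohomology_iso N R i E.

Definition zero_gvect (j : int) : lmodType k := 'rV[k]_0.

(* k[l], with k[l]_j = k_(l+j) *)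
Definition shift_k (l j : int) : lmodType k :=
  if l + j == 0 then k^o : lmodType k else 'rV[k]_0 : lmodType k.

Definition regular (d : nat) : Prop :=
  [/\ has_gldim d,
      forall i, i <> d -> Ext_iso i triv_gmod reg_gmod zero_gvect
    & exists l : int, Ext_iso d triv_gmod reg_gmod (shift_k l)].

Definition generates (M : gmod A) (n : nat) (g : 'I_n -> M) (S : M -> Prop) :=
  forall x, S x <-> exists c : 'I_n -> A, x = \sum_i g i <* c i.

Definition finitely_generated (M : gmod A) (S : M -> Prop) : Prop :=
  exists (n : nat) (g : 'I_n -> M), generates g S.

(* Exactness of (+)_l A[-t_l] -> (+)_i A[-e_i] -> S -> 0, where the first map is
   the homogeneous matrix r and the second sends the basis to g. *)
Definition finitely_presented (M : gmod A) (S : M -> Prop) : Prop :=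
  exists (n m : nat) (e : 'I_n -> int) (t : 'I_m -> int)
         (g : 'I_n -> M) (r : 'I_m -> 'I_n -> A),
  [/\ forall i, gdeg (e i) (g i),
      generates g S,
      forall l i, reg_deg (t l - e i) (r l i)
    & forall c : 'I_n -> A, \sum_i g i <* c i = 0 <->
        exists b : 'I_m -> A, forall i, c i = \sum_l r l i * b l].

Definition right_ideal (I : A -> Prop) : Prop :=
  [/\ I 0, forall x y, I x -> I y -> I (x + y)
    & forall x a, I x -> I (x * a)].

Definition homogeneous (I : A -> Prop) : Prop :=
  forall x, I x -> exists (s : seq nat) (f : nat -> A),
    (forall i, gr i (f i) /\ I (f i)) /\ x = \sum_(i <- s) f i.

Definition graded_coherent : Prop :=
  forall I : A -> Prop, right_ideal I -> homogeneous I ->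
    finitely_generated (M := reg_gmod) I ->
    finitely_presented (M := reg_gmod) I.

End Regular.

(* Main.v *)
From HB Require Import structures.
Require Import Defs.
From mathcomp Require Import all_boot all_order all_algebra zify boolp classical_sets.

(* Let x_1, ..., x_n be minimal homogeneous generators of A_+, of degrees d_i.
   The Gorenstein condition in degree 2 and projectivity of the second syzygy of
   k give y_1, ..., y_n such that the syzygies of (x_i) are the right multiples of
   (y_i), and such that the y_i generate A_+ as a left ideal; moreover n >= 2.
   Hence A has the single relation sum_i x_i y_i, and sending x_1, x_2 to u, v and
   the other x_i to 0 gives a surjection A -> B = k[u, v]/(f) with kernel J.
   B is noetherian by Hilbert's basis theorem and has no socle: if f divides up
   and vp then f divides p.  By the duality between (x_i) and (y_i), the latter
   makes J flat as a left ideal.  If K in A^m is the syzygy module of m elements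
   of A, flatness gives that the intersection of K with J^m is KJ, so K/KJ embeds
   in B^m and is finitely generated; so is K, by Nakayama's lemma. *)

Set Implicit Arguments.
Unset Strict Implicit.
Unset Printing Implicit Defensive.

Import Order.TTheory GRing.Theory Num.Theory.
Local Open Scope ring_scope.

(** * Hilbert's basis theorem *)

(** No growth condition is assumed, so A may be far from noetherian, and finiteness has to come from
    the smaller ring B. One variable would not do: k[u]/(f) has a nonzero socle when f is a power of
    u, whereas u, v is a regular sequence in k[u, v]. The flatness of J is a Tor computation.
    Tensoring the resolution 0 -> A[-l] -> (+)_i A[-d_i] -> A -> k with B identifies Tor_2(k, B)
    with the w in B such that all y_i w vanish. This is the socle of B because the y_i generate A_+
    as a left ideal; hence Tor_1(k, J) = Tor_2(k, B) = 0. Neither Tor nor B is constructed. Flatness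
    is stated by the equational criterion, and A -> B is replaced by a relation [rep] between
    elements of A and polynomials, single-valued only modulo f. Hilbert's theorem ignores the
    grading, so homogeneous coefficients must be recovered afterwards; [weight] serves that
    purpose. *)

Definition ideal (R : comNzRingType) (I : R -> Prop) :=
  [/\ I 0, forall x y, I x -> I y -> I (x + y) & forall a x, I x -> I (a * x)].

Definition combination (R : comNzRingType) (s : seq R) (x : R) :=
  exists c : nat -> R, x = \sum_(i < size s) c i * s`_i.

Definition noetherian (R : comNzRingType) :=
  forall I : R -> Prop, ideal I ->
    exists2 s : seq R, (forall i, (i < size s)%N -> I (s`_i))
                     & forall x, I x -> combination s x.

Lemma combination_ideal (R : comNzRingType) (s : seq R) : ideal (combination s).
Proof.
split; first by exists (fun=> 0); rewrite big1 // => i; rewrite mul0r.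
  move=> x y [c ->] [d ->]; exists (fun i => c i + d i).
  by rewrite -big_split; apply: eq_bigr => i; rewrite mulrDl.
move=> a x [c ->]; exists (fun i => a * c i).
by rewrite mulr_sumr; apply: eq_bigr => i; rewrite mulrA.
Qed.

Lemma combination_catl (R : comNzRingType) (s t : seq R) x :
  combination s x -> combination (s ++ t) x.
Proof.
move=> [c ->]; exists (fun i => if (i < size s)%N then c i else 0).
rewrite size_cat big_split_ord /= [X in _ = _ + X]big1 ?addr0.
  by apply: eq_bigr => i _; rewrite ltn_ord nth_cat ltn_ord.
by move=> i _; rewrite ltnNge leq_addr mul0r.
Qed.

Lemma combination_catr (R : comNzRingType) (s t : seq R) x :
  combination t x -> combination (s ++ t) x.
Proof.
move=> [c ->]; exists (fun i => if (i < size s)%N then 0 else c (i - size s)%N).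
rewrite size_cat big_split_ord /= [X in _ = X + _]big1 ?add0r.
  by apply: eq_bigr => i _; rewrite nth_cat ltnNge leq_addr /= addKn.
by move=> i _; rewrite ltn_ord mul0r.
Qed.

Lemma field_noetherian (k : fieldType) : noetherian k.
Proof.
move=> I [I0 _ IM]; have [[x [Ix x0]]|nI] := pselect (exists x, I x /\ x != 0).
  exists [:: x]; first by case.
  by move=> y Iy; exists (fun=> y / x); rewrite big_ord1 /= divfK.
exists [::] => // y Iy; exists (fun=> 0); rewrite big_ord0.
by apply/eqP/negPn/negP => y0; apply: nI; exists y.
Qed.

Section Hilbert.
Variables (R : comNzRingType) (I : {poly R} -> Prop).
Hypotheses (noethR : noetherian R) (idI : ideal I).

Lemma ideal_sub p q : I p -> I q -> I (p - q).
Proof.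
by case: idI => _ ID IM Ip Iq; rewrite -mulN1r; apply: ID => //; exact: IM.
Qed.

Lemma ideal_sum n (F : 'I_n -> {poly R}) : (forall i, I (F i)) -> I (\sum_i F i).
Proof. by case: idI => I0 ID _ IF; elim/big_rec: _ => // i x _; exact: ID. Qed.

Definition top_coef d a := exists2 p, I p & (size p <= d.+1)%N /\ p`_d = a.

Lemma top_coef_ideal d : ideal (top_coef d).
Proof.
have [I0 ID IM] := idI; split.
- by exists 0 => //; rewrite size_poly0 coef0.
- move=> _ _ [p Ip [sp <-]] [q Iq [sq <-]]; exists (p + q); first exact: ID.
  by rewrite coefD (leq_trans (size_polyD _ _)) // geq_max sp sq.
- move=> a _ [p Ip [sp <-]]; exists (a%:P * p); first exact: IM.
  by rewrite coefCM mul_polyC (leq_trans (size_scale_leq _ _)).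
Qed.

Lemma top_coefS d a : top_coef d a -> top_coef d.+1 a.
Proof.
have [_ _ IM] := idI; move=> [p Ip [sp <-]]; exists ('X * p); first exact: IM.
by rewrite mulrC coefMX (leq_trans (size_polyMleq _ _)) // size_polyX addn2.
Qed.

Lemma top_coef_leq d e a : (d <= e)%N -> top_coef d a -> top_coef e a.
Proof. by move=> /subnK<- ad; elim: (e - d)%N => //= j; exact: top_coefS. Qed.

Lemma choose_top s d : (forall i, (i < size s)%N -> top_coef d (s`_i)) ->
  exists2 t : seq {poly R}, size t = size s & forall i, (i < size s)%N ->
    [/\ I (t`_i), (size (t`_i)%R <= d.+1)%N & (t`_i)`_d = s`_i].
Proof.
elim: s => [|a s IH] H; first by exists [::].
have [i|t st tP] := IH; first exact: (H i.+1).
have [p Ip [sp pa]] := H 0%N isT.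
by exists (p :: t); [rewrite /= st | case].
Qed.

Lemma reduce_top (s : seq R) (t : seq {poly R}) d e p : size t = size s ->
    (forall i, (i < size s)%N ->
      [/\ I (t`_i), (size (t`_i)%R <= d.+1)%N & (t`_i)`_d = s`_i]) ->
    (d <= e)%N -> I p -> (size p <= e.+1)%N -> combination s p`_e ->
  exists q, [/\ combination t q, I (p - q) & (size (p - q)%R <= e)%N].
Proof.
move=> st tP de Ip sp [c pe]; have [_ _ IM] := idI.
exists (\sum_(i < size t) ((c i)%:P * 'X^(e - d)) * t`_i); split.
- by exists (fun i => (c i)%:P * 'X^(e - d)).
- by apply: ideal_sub => //; apply: ideal_sum => i; apply: IM;
    have [] := tP i; rewrite -?st.
- apply/leq_sizeP => j; rewrite leq_eqVlt => /predU1P[<-|ej].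
    rewrite coefB coef_sum pe st -sumrB big1 // => i _.
    rewrite -mulrA coefCM coefXnM ltnNge leq_subr /= subKn //.
    by have [_ _ ->] := tP i (ltn_ord i); rewrite subrr.
  rewrite coefB coef_sum [p`_j]nth_default ?(leq_trans sp) // sub0r.
  rewrite big1 ?oppr0 // => i _; rewrite -mulrA coefCM coefXnM.
  case: ifP => _; rewrite ?mulr0 // nth_default ?mulr0 //.
  have [|_ si _] := tP i; first by rewrite -st.
  by apply: leq_trans si _; lia.
Qed.

(** Each new top degree costs finitely many more generators, namely polynomials realising generators
    of its [top_coef] ideal. *)
Lemma gen_below d : exists2 t : seq {poly R},
  (forall i, (i < size t)%N -> I (t`_i)) &
  forall p, I p -> (size p <= d)%N -> combination t p.
Proof.
elim: d => [|d [t tI tP]].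
  exists [::] => // p _; rewrite size_poly_leq0 => /eqP->.
  by have [] := combination_ideal (R := {poly R}) [::].
have [s sI sP] := noethR (top_coef_ideal d).
have [t' st' t'P] := choose_top sI.
exists (t' ++ t) => [i|p Ip sp].
  rewrite size_cat nth_cat => it; case: ifP => it'; last first.
    by have := tI (i - size t')%N; apply; rewrite ltn_subLR // leqNgt it'.
  by have [] := t'P i; rewrite -?st'.
have [|q [tq Iq sq]] := reduce_top st' t'P (leqnn d) Ip sp.
  by apply: sP; exists p.
rewrite -(subrK q p); have [_ + _] := combination_ideal (t' ++ t).
by apply; [apply/combination_catr/tP | exact: combination_catl].
Qed.

End Hilbert.

(** The ideals [top_coef I d] increase with d. Generators of their union L all occur at one degree
    d; they clear the top coefficient of every polynomial of size greater than d, and [gen_below]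
    covers the rest. *)
Lemma poly_noetherian (R : comNzRingType) : noetherian R -> noetherian {poly R}.
Proof.
move=> noethR I idI; pose L a := exists d, top_coef I d a.
have [I0 ID IM] := idI.
have idL : ideal L.
  split; first by exists 0%N; have [] := top_coef_ideal idI 0.
    move=> a b [d ad] [e be]; exists (maxn d e).
    have [_ + _] := top_coef_ideal idI (maxn d e); apply.
      exact: top_coef_leq (leq_maxl _ _) ad.
    exact: top_coef_leq (leq_maxr _ _) be.
  by move=> a b [d bd]; exists d; have [_ _] := top_coef_ideal idI d; apply.
have [s sL sP] := noethR _ idL.
have [d sd] : exists d, forall i, (i < size s)%N -> top_coef I d (s`_i).
  elim: s sL {sP} => [|a s IH] sL; first by exists 0%N.
  have [i|d sd] := IH; first exact: (sL i.+1).
  have [e ae] := sL 0%N isT; exists (maxn d e) => -[|i] /= si.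
    exact: top_coef_leq (leq_maxr _ _) ae.
  exact: top_coef_leq (leq_maxl _ _) (sd i si).
have [t st tP] := choose_top sd.
have [t' t'I t'P] := gen_below noethR idI d.
exists (t ++ t') => [i|p].
  rewrite size_cat nth_cat => it; case: ifP => it'; last first.
    by have := t'I (i - size t)%N; apply; rewrite ltn_subLR // leqNgt it'.
  by have [] := tP i; rewrite -?st.
have [n] := ubnP (size p); elim: n p => // n IH p sp Ip.
have [_ CD _] := combination_ideal (t ++ t').
have [pd|dp] := leqP (size p) d; first exact/combination_catr/t'P.
have [e pe de] : exists2 e, size p = e.+1 & (d <= e)%N.
  by case: (size p) dp => // e de; exists e.
have [||q [tq Iq sq]] := reduce_top idI st tP de Ip; first by rewrite pe.
  by apply: sP; exists e, p => //; rewrite pe.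
rewrite -(subrK q p); apply: CD; last exact: combination_catl.
by apply: IH => //; rewrite (leq_ltn_trans sq) // -pe -ltnS.
Qed.

(** * Submodules of free modules over a noetherian ring *)

Definition submodule (R : comNzRingType) m (U : 'rV[R]_m -> Prop) :=
  [/\ U 0, forall p q, U p -> U q -> U (p + q) & forall a p, U p -> U (a *: p)].

Lemma submodule_mulmx (R : comNzRingType) m r (U : 'rV[R]_m -> Prop)
    (B : 'M_(r, m)) (q : 'rV_r) :
  submodule U -> (forall j, U (row j B)) -> U (q *m B).
Proof.
move=> [U0 UD UZ] UB; rewrite mulmx_sum_row.
by elim/big_rec: _ => // i p _ Up; apply: UD => //; apply: UZ.
Qed.

(** Induction on m: lift generators of the ideal of first coordinates, then add generators of the
    part with first coordinate 0. *)
Lemma submodule_fingen (R : comNzRingType) m (U : 'rV[R]_m -> Prop) :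
  noetherian R -> submodule U ->
  exists r (B : 'M_(r, m)), (forall j, U (row j B)) /\
    forall p, U p -> exists q : 'rV_r, p = q *m B.
Proof.
move=> noethR; elim: m U => [|m IH] U subU; have [U0 UD UZ] := subU.
  exists 0%N, 0; split; first by case.
  by move=> p _; exists 0; rewrite mul0mx (thinmx0 p).
pose I a := exists2 p, U p & p 0 0 = a.
have [|s sI sP] := noethR I.
  split; first by exists 0; rewrite ?mxE.
    by move=> _ _ [p Up <-] [q Uq <-]; exists (p + q); rewrite ?mxE //; exact: UD.
  by move=> a _ [p Up <-]; exists (a *: p); rewrite ?mxE //; exact: UZ.
have /choice[g gP] i : exists p : 'rV_m.+1,
    (i < size s)%N -> U p /\ p 0 0 = s`_i.
  have [/sI[p Up ps]|_] := boolP (i < size s)%N; last by exists 0.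
  by exists p.
pose B0 : 'M_(size s, m.+1) := \matrix_i g i.
pose U' (p : 'rV_m) := U (row_mx (0 : 'rV_1) p).
have [|r [B [BU BP]]] := IH U'.
  rewrite /U'; split; first by rewrite row_mx0.
    move=> p q Up Uq.
    have -> : row_mx 0 (p + q) = row_mx (0 : 'rV_1) p + row_mx 0 q.
      by rewrite add_row_mx addr0.
    exact: UD Up Uq.
  move=> a p Up; have -> : row_mx 0 (a *: p) = a *: row_mx (0 : 'rV_1) p.
    by rewrite scale_row_mx scaler0.
  exact: UZ Up.
have B0U j : U (row j B0) by rewrite rowK; have [] := gP j (ltn_ord j).
exists (size s + r)%N, (col_mx B0 (row_mx (0 : 'M_(r, 1)) B)); split.
  move=> j; rewrite -[j]splitK; case: (split j) => i /=.
    by rewrite rowKu.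
  rewrite rowKd; have := BU i; rewrite /U'.
  have <- : row i (row_mx (0 : 'M_(r, 1)) B) = row_mx 0 (row i B).
    by rewrite row_row_mx row0.
  by [].
move=> p Up; have [c pc] := sP (p 0 0) (ex_intro2 _ _ p Up erefl).
pose q : 'rV_(size s) := \row_i c i.
have Upq : U (p - q *m B0).
  by rewrite -scaleN1r; apply: UD => //; apply: UZ; exact: submodule_mulmx.
have pq0 : (p - q *m B0) 0 0 = 0.
  rewrite !mxE pc -sumrB big1 // => i _; rewrite !mxE.
  by have [_ ->] := gP i (ltn_ord i); rewrite subrr.
have pqE : p - q *m B0 = row_mx (0 : 'rV_1) (@rsubmx _ 1 1 m (p - q *m B0)).
  have <- : @lsubmx _ 1 1 m (p - q *m B0) = 0.
    apply/rowP => i; rewrite ord1 mxE [RHS]mxE -[RHS]pq0; congr (_ _ _).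
    exact/val_inj.
  by rewrite (@hsubmxK _ 1 1 m).
have [|q' q'E] := BP (@rsubmx _ 1 1 m (p - q *m B0)); first by rewrite /U' -pqE.
exists (row_mx q q'); rewrite mul_row_col.
have -> : q' *m row_mx (0 : 'M_(r, 1)) B = row_mx 0 (q' *m B).
  by rewrite mul_mx_row mulmx0.
by rewrite -q'E -pqE addrC subrK.
Qed.

(** Finitely many generators of the span of S involve finitely many rows of S, which therefore
    generate it too. Generators inside S are essential later, when S comes from homogeneous syzygies
    and need not be a submodule. *)
Lemma noetherian_rows (R : comNzRingType) m (S : 'rV[R]_m -> Prop) :
  noetherian R ->
  exists r (B : 'M_(r, m)), (forall j, S (row j B)) /\
    forall p, S p -> exists q : 'rV_r, p = q *m B.
Proof.
move=> noethR.
pose U p := exists r (B : 'M_(r, m)) (q : 'rV_r),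
  (forall j, S (row j B)) /\ p = q *m B.
have stack r1 r2 (B1 : 'M_(r1, m)) (B2 : 'M_(r2, m)) :
    (forall j, S (row j B1)) -> (forall j, S (row j B2)) ->
    forall j, S (row j (col_mx B1 B2)).
  by move=> S1 S2 j; rewrite -[j]splitK; case: (split j) => i /=;
    rewrite ?rowKu ?rowKd.
have subU : submodule U.
  split; first by exists 0%N, 0, 0; rewrite mul0mx; split=> // -[].
    move=> _ _ [r1 [B1 [q1 [S1 ->]]]] [r2 [B2 [q2 [S2 ->]]]].
    exists (r1 + r2)%N, (col_mx B1 B2), (row_mx q1 q2).
    by split; [exact: stack | rewrite mul_row_col].
  by move=> a _ [r [B [q [SB ->]]]]; exists r, B, (a *: q); rewrite scalemxAl.
have [r [B [BU BP]]] := submodule_fingen noethR subU.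
have [r' [B' [Q [SB' BE]]]] : exists r' (B' : 'M_(r', m)) (Q : 'M_(r, r')),
    (forall j, S (row j B')) /\ B = Q *m B'.
  elim: r B BU {BP} => [|r IH] B BU.
    by exists 0%N, 0, 0; rewrite mul0mx (flatmx0 B); split=> // -[].
  have [|r1 [B1 [Q1 [S1 E1]]]] := IH (dsubmx (B : 'M_(1 + r, m))).
    move=> j; have := BU (rshift 1 j); congr U.
    by apply/rowP => i; rewrite !mxE.
  have [r2 [B2 [q2 [S2 E2]]]] := BU (lshift r (0 : 'I_1)).
  exists (r2 + r1)%N, (col_mx B2 B1), (block_mx q2 0 0 Q1 : 'M_(1 + r, _)).
  split; first exact: stack.
  have := mul_block_col q2 0 0 Q1 B2 B1.
  rewrite !mul0mx addr0 add0r -E1 -E2 => E; apply: (etrans _ (esym E)).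
  rewrite -[LHS](@vsubmxK _ 1 r m); congr col_mx.
  by apply/rowP => j; rewrite !mxE.
exists r', B'; split=> // p Sp; have [|q ->] := BP p.
  exists 1%N, p, 1; split; last by rewrite mul1mx.
  by move=> j; rewrite row_id // ord1.
by exists (q *m Q); rewrite BE mulmxA.
Qed.

(** * Degrees in A, indexed by the integers *)

Section Degrees.
Variables (k : fieldType) (A : gralg k).
Implicit Types (a b : A) (i j e : int).

Lemma reg_deg0 i : reg_deg i (0 : A).
Proof. by case: i => // j; exact: gr0. Qed.

Lemma reg_degD i a b : reg_deg i a -> reg_deg i b -> reg_deg i (a + b).
Proof. by case: i => /= j; [exact: grD | move=> -> ->; rewrite addr0]. Qed.

Lemma reg_degN i a : reg_deg i a -> reg_deg i (- a).
Proof. by case: i => /= j; [exact: grN | move=> ->; rewrite oppr0]. Qed.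

Lemma reg_degB i a b : reg_deg i a -> reg_deg i b -> reg_deg i (a - b).
Proof. by move=> ? ?; apply: reg_degD => //; exact: reg_degN. Qed.

Lemma reg_degZ i c a : reg_deg i a -> reg_deg i (c *: a).
Proof. by case: i => /= j; [exact: grZ | move=> ->; rewrite scaler0]. Qed.

Lemma reg_degM i j a b : reg_deg i a -> reg_deg j b -> reg_deg (i + j) (a * b).
Proof.
case: i => i ai; last by rewrite [a]ai mul0r => _; exact: reg_deg0.
case: j => j bj; last by rewrite [b]bj mulr0; exact: reg_deg0.
exact: (gr_mul ai bj).
Qed.

Lemma reg_deg_neg i a : i < 0 -> reg_deg i a -> a = 0.
Proof. by case: i => // j. Qed.

Lemma reg_deg_sum i (I : Type) (r : seq I) (P : pred I) (F : I -> A) :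
  (forall s, P s -> reg_deg i (F s)) -> reg_deg i (\sum_(s <- r | P s) F s).
Proof.
by move=> FP; elim/big_rec: _ => [|s x /FP]; [exact: reg_deg0 | exact: reg_degD].
Qed.

Lemma reg_deg0P a : reg_deg 0 a -> exists c : k, a = c%:A.
Proof. by move/gr_connected. Qed.

Lemma reg_deg1 c : reg_deg 0 (c%:A : A).
Proof. by apply/gr_connected; exists c. Qed.

Lemma aug_scal (c : k) : aug (c%:A : A) = c.
Proof. by apply: augE; rewrite subrr; exact: Aplus0. Qed.

Lemma aug0 : aug (0 : A) = 0.
Proof. by rewrite -(scale0r 1) aug_scal. Qed.

Lemma aug_sum (I : Type) (r : seq I) (P : pred I) (F : I -> A) :
  aug (\sum_(s <- r | P s) F s) = \sum_(s <- r | P s) aug (F s).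
Proof. by elim/big_rec2: _ => [|s u v _ <-]; [exact: aug0 | rewrite augD]. Qed.

Lemma aug_deg i a : reg_deg i a -> i != 0 -> aug a = 0.
Proof. by case: i => [[|i]|i] //=; [move/aug_hom | move=> ->; rewrite aug0]. Qed.

Definition homogeneous_mx p m (e : 'I_p -> int) (q : 'I_m -> int)
    (a : 'M[A]_(p, m)) :=
  forall r s, reg_deg (e r - q s) (a r s).

Lemma homogeneous_mulmx p m r (e : 'I_p -> int) (q : 'I_m -> int) (t : 'I_r -> int)
    (a : 'M_(p, m)) (b : 'M_(m, r)) :
  homogeneous_mx e q a -> homogeneous_mx q t b -> homogeneous_mx e t (a *m b).
Proof.
move=> aP bP u w; rewrite mxE; apply: reg_deg_sum => s _.
by rewrite -[e u](subrK (q s)) -addrA; exact: reg_degM.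
Qed.

End Degrees.

(* Exactness of 0 -> A[-l] -> (+)_i A[-d_i] -> A -> k in the middle (x_gen, xy0,
   x_syz) and of its A-dual at the end (y_gen).  Since reg_deg vanishes in negative
   degrees, no side condition such as d_i <= e is needed. *)
Record dim2_data (k : fieldType) (A : gralg k) (n : nat) (d : 'I_n -> nat) (l : int)
    (x y : 'I_n -> A) : Prop := Dim2Data {
  d_gt0 : forall i, (0 < d i)%N;
  x_deg : forall i, reg_deg (d i) (x i);
  y_deg : forall i, reg_deg (l - (d i)%:Z) (y i);
  x_gen : forall (e : nat) a, gr e.+1 a -> exists2 b : 'I_n -> A,
    forall i, reg_deg (e.+1%:Z - (d i)%:Z) (b i) & a = \sum_i x i * b i;
  xy0 : \sum_i x i * y i = 0;
  x_syz : forall (e : int) (b : 'I_n -> A),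
    (forall i, reg_deg (e - (d i)%:Z) (b i)) -> \sum_i x i * b i = 0 ->
    exists2 w, reg_deg (e - l) w & forall i, b i = y i * w;
  y_gen : forall (e : nat) a, gr e.+1 a -> exists2 b : 'I_n -> A,
    forall i, reg_deg (e.+1%:Z - (l - (d i)%:Z)) (b i) & a = \sum_i b i * y i
}.

(** * Flatness of socle-free left ideals *)

Section Flat.
Variables (k : fieldType) (A : gralg k) (n : nat) (d : 'I_n -> nat) (l : int).
Variables (x y : 'I_n -> A).
Hypothesis D : dim2_data d l x y.

Variable J : int -> A -> Prop.
Hypothesis J_deg : forall e a, J e a -> reg_deg e a.
Hypothesis J0 : forall e, J e 0.
Hypothesis JD : forall e a b, J e a -> J e b -> J e (a + b).
Hypothesis JM : forall i e a b, reg_deg i a -> J e b -> J (i + e) (a * b).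
(** An elementary form of Tor_2(k, A/J) = 0. *)
Hypothesis J_socle : forall e w, reg_deg e w ->
  (forall i, J (l - (d i)%:Z + e) (y i * w)) -> J e w.

Lemma J_sum e (I : Type) (r : seq I) (P : pred I) (F : I -> A) :
  (forall s, P s -> J e (F s)) -> J e (\sum_(s <- r | P s) F s).
Proof.
by move=> FP; elim/big_rec: _ => [|s z /FP]; [exact: J0 | exact: JD].
Qed.

Definition trivial_relations p (e : 'I_p -> int) := forall m (q : 'I_m -> int)
    (a : 'M[A]_(p, m)) (c : 'cV[A]_m),
  homogeneous_mx e q a -> (forall s, J (q s) (c s 0)) -> a *m c = 0 ->
  exists r (t : 'I_r -> int) (h : 'M[A]_(m, r)) (v : 'cV[A]_r),
    [/\ homogeneous_mx q t h, forall j, J (t j) (v j 0), c = h *m v & a *m h = 0].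

(** Solve the first equation by c = h v; the others become relations on v, whose entries are again
    in J. Systems are needed because [trivial_relation] trades one equation for n equations of lower
    degree. *)
Lemma trivial_system p (e : 'I_p -> int) :
  (forall i, trivial_relations (fun _ : 'I_1 => e i)) -> trivial_relations e.
Proof.
elim: p e => [|p IH] e H m q a c aP cJ ac.
  exists m, q, 1%:M, c; split=> //; rewrite ?mul1mx //; last by apply/matrixP => -[].
  move=> i j; rewrite mxE; case: eqP => [->|_]; last exact: reg_deg0.
  by rewrite subrr -[1%R]scale1r; exact: reg_deg1.
have [||r [t [h [v [hP vJ cE ah]]]]] := H ord0 m q (row ord0 a) c _ cJ.
- by move=> i s; rewrite mxE; exact: aP.
- by rewrite -row_mul ac row0.
pose a' : 'M_(p, m) := \matrix_(i, j) a (lift ord0 i) j.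
have a'P : homogeneous_mx (fun i => e (lift ord0 i)) q a'.
  by move=> i j; rewrite mxE; exact: aP.
have a'E s (B : 'M_(m, s)) i j : (a' *m B) i j = (a *m B) (lift ord0 i) j.
  by rewrite !mxE; apply: eq_bigr => z _; rewrite mxE.
have [||r' [t' [h' [v' [h'P v'J vE ah']]]]] :=
  IH _ (fun i => H (lift ord0 i)) r t (a' *m h) v _ vJ.
- exact: homogeneous_mulmx a'P hP.
- by rewrite -mulmxA -cE; apply/matrixP => i j; rewrite a'E ac !mxE.
exists r', t', (h *m h'), v'; split=> //.
- exact: homogeneous_mulmx hP h'P.
- by rewrite cE vE mulmxA.
apply/matrixP => i j; have [i'|] := unliftP ord0 i => ->.
  by rewrite -a'E mulmxA ah' !mxE.
have /rowP/(_ j) : row ord0 (a *m (h *m h')) = 0.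
  by rewrite row_mul mulmxA ah mul0mx.
by rewrite mxE !mxE.
Qed.

(* Equational criterion: the left ideal J is flat.  If the coefficients a_s lie
   in A_+, write a_s = sum_i x_i a_is; then sum_s a_is c_s = y_i w, the socle
   hypothesis puts w in J, and these n relations have smaller degree. *)
Lemma trivial_relation (e : int) : trivial_relations (fun _ : 'I_1 => e).
Proof.
have [N] : exists N : nat, e < N%:Z by exists `|e|.+1%N; lia.
elim: N e => [|N IH] e eN m q a c aP cJ ac.
  (* Here e < 0: if a_s is nonzero then q_s <= e < 0, so c_s = 0. Projecting onto the coordinates
     with a_s = 0 thus fixes c and kills a. *)
  exists m, q, (\matrix_(s, r) ((s == r) && (a 0 s == 0))%:R), c; split=> //.
  - move=> s r; rewrite mxE; case: eqP => [->|_]; last exact: reg_deg0.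
    case: eqP => _; last exact: reg_deg0.
    by rewrite subrr -[_%:R]scale1r; exact: reg_deg1.
  - apply/colP => s; rewrite mxE (bigD1 s) //= big1 => [|r rs]; rewrite !mxE.
      rewrite eqxx addr0; case: eqP => [_|as0]; first by rewrite mul1r.
      rewrite mul0r; apply: (@reg_deg_neg _ _ (q s)); last exact: J_deg.
      rewrite ltNge; apply/negP => qs; apply: as0.
      by apply: reg_deg_neg (aP 0 s); lia.
    by rewrite eq_sym (negbTE rs) mul0r.
  - apply/rowP => r; rewrite !mxE big1 // => s _; rewrite mxE.
    case: eqP => _; rewrite ?mulr0 //.
    by case: eqP => as0; rewrite ?as0 ?mul0r ?mulr0.
have [[s as0]|aug_a] := pselect (exists s, aug (a 0 s) != 0).
  have qs : q s = e.
    apply/eqP; rewrite eq_sym -subr_eq0.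
    by apply: contraNT as0 => /(aug_deg (aP 0 s))->.
  have := aP 0 s; rewrite qs subrr => /reg_deg0P[z az].
  have z0 : z != 0 by rewrite -(aug_scal A z) -az.
  (* The coefficient a_s is a nonzero scalar, so [1%:M - E *m a] is a projector onto the kernel of
     a, and it fixes c. *)
  pose E : 'cV[A]_m := \col_i if i == s then z^-1%:A else 0.
  have aE : a *m E = 1%:M.
    apply/matrixP => i j; rewrite !ord1 mxE (bigD1 s) //= big1 => [|r rs].
      by rewrite !mxE eqxx az mulr_algl scalerA divff // scale1r addr0.
    by rewrite mxE (negbTE rs) mulr0.
  exists m, q, (1%:M - E *m a), c; split=> //.
  - move=> i j; rewrite !mxE big_ord1 !mxE; apply: reg_degB.
      case: eqP => [->|_]; last exact: reg_deg0.
      by rewrite subrr -[_%:R]scale1r; exact: reg_deg1.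
    case: eqP => [->|_]; last by rewrite mul0r; exact: reg_deg0.
    by rewrite qs mulr_algl; apply: reg_degZ; exact: aP.
  - by rewrite mulmxBl mul1mx -mulmxA ac mulmx0 subr0.
  - by rewrite mulmxBr mulmx1 mulmxA aE mul1mx subrr.
have /choice[B BP] s : exists b : 'I_n -> A,
    (forall i, reg_deg (e - q s - (d i)%:Z) (b i)) /\ a 0 s = \sum_i x i * b i.
  have := aP 0 s; case E : (e - q s) => [[|j]|j] /=.
  - move=> /reg_deg0P[z az]; have z0 : z = 0.
      apply/eqP/negPn/negP => z0; apply: aug_a; exists s.
      by rewrite az aug_scal.
    exists (fun=> 0); split=> [i|]; first exact: reg_deg0.
    by rewrite az z0 scale0r big1 // => i _; rewrite mulr0.
  - by move=> /(x_gen D)[b bP bE]; exists b.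
  - move=> ->; exists (fun=> 0); split=> [i|]; first exact: reg_deg0.
    by rewrite big1 // => i _; rewrite mulr0.
pose b : 'M[A]_(n, m) := \matrix_(i, s) B s i.
pose X : 'rV[A]_n := \row_i x i; pose Y : 'cV[A]_n := \col_i y i.
have aE : a = X *m b.
  apply/rowP => s; rewrite mxE; have [_ ->] := BP s.
  by apply: eq_bigr => i _; rewrite !mxE.
have bP : homogeneous_mx (fun i => e - (d i)%:Z) q b.
  by move=> i s; rewrite mxE addrAC; have [] := BP s.
have XY : X *m Y = 0.
  apply/matrixP => i j; rewrite !mxE -[RHS](xy0 D).
  by apply: eq_bigr => s _; rewrite !mxE.
have bcJ i : J (e - (d i)%:Z) ((b *m c) i 0).
  rewrite mxE; apply: J_sum => s _; rewrite -[_ - _](subrK (q s)).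
  by apply: JM => //; exact: bP.
have [||w w_deg wE] := x_syz D (e := e) (b := fun i => (b *m c) i 0).
- by move=> i; exact: J_deg.
- have -> : \sum_i x i * (b *m c) i 0 = (X *m (b *m c)) 0 0.
    by rewrite [RHS]mxE; apply: eq_bigr => i _; rewrite [X 0 i]mxE.
  by rewrite mulmxA -aE ac mxE.
have wJ : J (e - l) w.
  apply: J_socle => // i; rewrite -wE.
  by have -> : l - (d i)%:Z + (e - l) = e - (d i)%:Z by lia.
(* The equations b c = Y w are n relations on the enlarged vector (c, w), which has entries in J.
   The upper block of the solution h suffices, since a = X b and X Y = 0. *)
pose q' (s : 'I_(m + 1)) : int :=
  match split s with inl s => q s | inr _ => e - l end.
have [|||r [t [h [v [hP vJ cwE bh]]]]] := trivial_system
  (fun i => IH (e - (d i)%:Z) ltac:(have := d_gt0 D i; lia))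
  (q := q') (a := row_mx b (- Y)) (c := col_mx c (w%:M : 'M_1)).
- move=> i s; rewrite mxE /q'; case: split_ordP => j _; first exact: bP.
  rewrite !mxE; apply: reg_degN.
  have -> : e - (d i)%:Z - (e - l) = l - (d i)%:Z by lia.
  exact: (y_deg D).
- by move=> s; rewrite mxE /q'; case: split_ordP => j _ //; rewrite !mxE ord1.
- rewrite mul_row_col mulNmx; apply/colP => i.
  by rewrite !mxE big_ord1 !mxE eqxx -wE mxE subrr.
exists r, t, (usubmx h), v; split=> //.
- move=> i j; rewrite mxE; have := hP (lshift 1 i) j.
  by rewrite /q' (unsplitK (inl i)).
- by have := congr1 usubmx cwE; rewrite col_mxKu mul_usub_mx.
- rewrite -{1}[h]vsubmxK mul_row_col mulNmx in bh.
  move/eqP: bh; rewrite subr_eq0 => /eqP bh.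
  by rewrite aE -mulmxA bh mulmxA XY mul0mx.
Qed.

End Flat.

(** * The commutative quotient *)

(** For f nonzero, cancelling it gives v g = u h; setting v = 0 shows that v divides h, and the
    quotient is the required q. *)
Lemma bivariate_divides (R : idomainType) (f p g h : {poly {poly R}}) :
  'X%:P * p = f * g -> 'X * p = f * h -> exists q, p = f * q.
Proof.
have [->|f0] := eqVneq f 0.
  rewrite !mul0r => _ /eqP; rewrite mulf_eq0 polyX_eq0 /= => /eqP->.
  by exists 0; rewrite mul0r.
move=> Eg Eh.
have gh : 'X * g = 'X%:P * h.
  by apply: (mulfI f0); rewrite mulrCA -Eg [RHS]mulrCA -Eh mulrCA.
have /factor_theorem[q hE] : root h 0.
  have := congr1 (fun r : {poly {poly R}} => r`_0) gh.
  rewrite coefXM coefCM => /esym/eqP.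
  by rewrite /= mulf_eq0 polyX_eq0 /= => /eqP h0; rewrite /root horner_coef0 h0.
rewrite subr0 in hE; exists q.
have X0 : ('X : {poly {poly R}}) != 0 by rewrite polyX_eq0.
by apply: (mulfI X0); rewrite Eh hE mulrA mulrC.
Qed.

Section Abelianization.
Variables (k : fieldType) (A : gralg k) (n : nat) (d : 'I_n -> nat) (l : int).
Variables (x y : 'I_n -> A).
Hypothesis D : dim2_data d l x y.
Variables i0 i1 : 'I_n.
Hypothesis i01 : i0 != i1.

Notation P := {poly {poly k}}.

(** The inner variable ['X%:P] is u and the outer variable ['X] is v. *)
Definition pvar (i : 'I_n) : P :=
  if i == i0 then 'X%:P else if i == i1 then 'X else 0.

(* [rep e a p]: a can be written as a noncommutative polynomial of degree e in
   the x_i whose image under x_i |-> pvar i is p. *)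
Inductive rep : int -> A -> P -> Prop :=
| rep_scal c : rep 0 c%:A c%:P%:P
| rep0 e : rep e 0 0
| repD e a b p q : rep e a p -> rep e b q -> rep e (a + b) (p + q)
| repX e i a p : rep e a p -> rep ((d i)%:Z + e) (x i * a) (pvar i * p).

Lemma rep_deg e a p : rep e a p -> reg_deg e a.
Proof.
elim=> {e a p}.
- by move=> c; exact: reg_deg1.
- by move=> e; exact: reg_deg0.
- by move=> e a b p q _ ? _ ?; exact: reg_degD.
- by move=> e i a p _; apply: reg_degM; exact: (x_deg D).
Qed.

Lemma repZ c e a p : rep e a p -> rep e (c *: a) (c%:P%:P * p).
Proof.
elim=> {e a p}.
- by move=> c'; rewrite scalerA -!polyCM; exact: rep_scal.
- by move=> e; rewrite scaler0 mulr0; exact: rep0.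
- by move=> e a b p q _ ? _ ?; rewrite scalerDr mulrDr; exact: repD.
- by move=> e i a p _ ?; rewrite scalerAr mulrCA; exact: repX.
Qed.

Lemma repB e a b p q : rep e a p -> rep e b q -> rep e (a - b) (p - q).
Proof.
move=> ap /(repZ (-1)); rewrite scaleN1r !polyCN mulN1r; exact: repD.
Qed.

Lemma rep_sum e (I : Type) (r : seq I) (a : I -> A) (p : I -> P) :
  (forall s, rep e (a s) (p s)) ->
  rep e (\sum_(s <- r) a s) (\sum_(s <- r) p s).
Proof.
by move=> H; elim/big_rec2: _ => [|s b q _]; [exact: rep0 | exact: repD].
Qed.

Lemma repM e a p e' b q : rep e a p -> rep e' b q -> rep (e + e') (a * b) (p * q).
Proof.
move=> + bq; elim=> {e a p}.
- by move=> c; rewrite add0r mulr_algl; exact: repZ.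
- by move=> e; rewrite !mul0r; exact: rep0.
- by move=> e a a' p p' _ ? _ ?; rewrite !mulrDl; exact: repD.
- by move=> e i a p _ ?; rewrite -!mulrA -addrA; exact: repX.
Qed.

Lemma rep_neg e a p : rep e a p -> e < 0 -> p = 0.
Proof.
elim=> {e a p} //.
- by move=> e a b p q _ IHp _ IHq e0; rewrite IHp ?IHq ?addr0.
- by move=> e i a p _ IH e0; rewrite IH ?mulr0 //; lia.
Qed.

Lemma rep_exists e a : reg_deg e a -> exists p, rep e a p.
Proof.
have [N] : exists N : nat, e < N%:Z by exists `|e|.+1%N; lia.
elim: N e a => [|N IH] e a eN ea.
  by exists 0; rewrite (reg_deg_neg eN ea); exact: rep0.
case: e eN ea => [[|e]|e] eN ea.
- by have [c ->] := reg_deg0P ea; exists c%:P%:P; exact: rep_scal.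
- have [b bP ->] := x_gen D ea.
  have /choice[p pP] i : exists p, rep (e.+1%:Z - (d i)%:Z) (b i) p.
    by apply: IH => //; have := d_gt0 D i; lia.
  exists (\sum_i pvar i * p i); apply: rep_sum => i.
  by rewrite -[e.+1%:Z](subrK (d i)%:Z) addrC; exact: repX.
- by exists 0; rewrite [a]ea; exact: rep0.
Qed.

Lemma rep_split e a p : rep e a p -> exists c (b : 'I_n -> A) (q : 'I_n -> P),
  [/\ forall i, rep (e - (d i)%:Z) (b i) (q i), a = c%:A + \sum_i x i * b i
    & p = c%:P%:P + \sum_i pvar i * q i].
Proof.
elim=> {e a p}.
- move=> c; exists c, (fun=> 0), (fun=> 0); split=> [i||]; first exact: rep0.
    by rewrite big1 ?addr0 // => i _; rewrite mulr0.
  by rewrite big1 ?addr0 // => i _; rewrite mulr0.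
- move=> e; exists 0, (fun=> 0), (fun=> 0); split=> [i||]; first exact: rep0.
    by rewrite scale0r big1 ?addr0 // => i _; rewrite mulr0.
  by rewrite big1 ?addr0 // => i _; rewrite mulr0.
- move=> e a a' p p' _ [c [b [q [bq -> ->]]]] _ [c' [b' [q' [bq' -> ->]]]].
  exists (c + c'), (fun i => b i + b' i), (fun i => q i + q' i).
  split=> [i||]; first exact: repD.
    rewrite scalerDl addrACA -big_split; congr (_ + _).
    by apply: eq_bigr => i _; rewrite mulrDr.
  rewrite !polyCD addrACA -big_split; congr (_ + _).
  by apply: eq_bigr => i _; rewrite mulrDr.
- move=> e i a p ap _.
  exists 0, (fun j => if j == i then a else 0), (fun j => if j == i then p else 0).
  split=> [j||].
  + by case: eqP => [->|_]; [rewrite addrC addKr | exact: rep0].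
  + rewrite scale0r add0r (bigD1 i) //= eqxx big1 ?addr0 // => j /negbTE->.
    by rewrite mulr0.
  + rewrite add0r (bigD1 i) //= eqxx big1 ?addr0 // => j /negbTE->.
    by rewrite mulr0.
Qed.

Variable Y : 'I_n -> P.
Hypothesis repY : forall i, rep (l - (d i)%:Z) (y i) (Y i).

(** This is f. It is 0 when A is the polynomial ring in two variables, which is why
    [bivariate_divides] treats f = 0 as well. *)
Definition relator : P := \sum_i pvar i * Y i.
Definition divides_by_relator p := exists q, p = relator * q.

Lemma divides_add p q :
  divides_by_relator p -> divides_by_relator q -> divides_by_relator (p + q).
Proof. by move=> [p' ->] [q' ->]; exists (p' + q'); rewrite mulrDr. Qed.

Lemma divides_mul r p : divides_by_relator p -> divides_by_relator (r * p).
Proof. by move=> [p' ->]; exists (r * p'); rewrite mulrCA. Qed.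

Lemma divides_sum (I : Type) (r : seq I) (p : I -> P) :
  (forall i, divides_by_relator (p i)) -> divides_by_relator (\sum_(i <- r) p i).
Proof.
move=> H; elim/big_rec: _ => [|i q _]; last exact: divides_add.
by exists 0; rewrite mulr0.
Qed.

(* That is, A is presented by the generators x_i and the one relation
   sum_i x_i y_i, so x_i |-> pvar i induces a map A -> k[u, v] / (relator). *)
Lemma rep_zero e p : rep e 0 p -> divides_by_relator p.
Proof.
have [N] : exists N : nat, e < N%:Z by exists `|e|.+1%N; lia.
elim: N e p => [|N IH] e p eN ep.
  by exists 0; rewrite mulr0; exact: rep_neg ep eN.
have [c [b [q [bq a0 ->]]]] := rep_split ep.
have c0 : c = 0.
  have := congr1 (@aug k A) a0.
  rewrite aug0 augD aug_scal aug_sum big1 ?addr0 // => i _.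
  rewrite augM (aug_deg (x_deg D i)) ?mul0r //.
  by rewrite eqz_nat -lt0n (d_gt0 D).
rewrite c0 scale0r add0r in a0.
have [i|w w_deg wE] := x_syz D (e := e) _ (esym a0); first exact: rep_deg (bq i).
have [r wr] := rep_exists w_deg.
(* Since b_i = y_i w, the polynomial q_i - Y_i r represents 0 in degree e - d_i, where induction
   applies. *)
have qE i : divides_by_relator (q i - Y i * r).
  apply: (IH (e - (d i)%:Z)); first by have := d_gt0 D i; lia.
  rewrite -(subrr (b i)) {2}wE; apply: repB => //.
  have -> : e - (d i)%:Z = l - (d i)%:Z + (e - l) by lia.
  exact: repM.
have -> : c%:P%:P + \sum_i pvar i * q i =
    \sum_i pvar i * (q i - Y i * r) + relator * r.
  rewrite c0 !polyC0 add0r /relator mulr_suml -big_split.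
  by apply: eq_bigr => i _ /=; rewrite mulrBr -mulrA subrK.
apply: divides_add; last by exists r.
by apply: divides_sum => i; apply: divides_mul.
Qed.

Definition J e a := exists2 p, rep e a p & divides_by_relator p.

(** Membership in J does not depend on the representative: two of them differ by a representative of
    0. *)
Lemma J_rep e a p : J e a -> rep e a p -> divides_by_relator p.
Proof.
move=> [q aq fq] ap; rewrite -(subrK q p); apply: divides_add => //.
by apply: (@rep_zero e); rewrite -(subrr a); exact: repB.
Qed.

Lemma J_deg e a : J e a -> reg_deg e a.
Proof. by case=> p /rep_deg. Qed.

Lemma J0 e : J e 0.
Proof. by exists 0; [exact: rep0 | exists 0; rewrite mulr0]. Qed.

Lemma JD e a b : J e a -> J e b -> J e (a + b).
Proof.
move=> [p ap fp] [q bq fq].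
by exists (p + q); [exact: repD | exact: divides_add].
Qed.

Lemma JM i e a b : reg_deg i a -> J e b -> J (i + e) (a * b).
Proof.
move=> /rep_exists[p ap] [q bq fq].
by exists (p * q); [exact: repM | exact: divides_mul].
Qed.

(** The relator has no constant term. Hence J lies in positive degrees, as Nakayama's argument
    requires. *)
Lemma J_scal c : J 0 c%:A -> c = 0.
Proof.
have f0 : relator.[0].[0] = 0.
  rewrite /relator !horner_sum big1 // => i _; rewrite !hornerM /pvar.
  case: eqP => _; first by rewrite hornerC hornerX mul0r.
  by case: eqP => _; rewrite ?hornerX !horner0 mul0r.
move=> /J_rep/(_ (rep_scal c))[q /(congr1 (fun p : P => p.[0].[0]))].
by rewrite !hornerC !hornerM f0 mul0r.
Qed.

(** Each x_i is a left combination of the y_j, so every x_i w lies in J; the cases i0 and i1 say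
    that f divides u p and v p. *)
Lemma J_socle e w : reg_deg e w ->
  (forall i, J (l - (d i)%:Z + e) (y i * w)) -> J e w.
Proof.
move=> w_deg yw; have [p wp] := rep_exists w_deg; exists p => //.
have xw i : J ((d i)%:Z + e) (x i * w).
  have := x_deg D i; case E: (d i) (d_gt0 D i) => [//|di] _ /= /(y_gen D)[b bP ->].
  rewrite mulr_suml; elim/big_rec: _ => [|j a _]; first exact: J0.
  apply: JD; rewrite -mulrA.
  have -> : di.+1%:Z + e = di.+1%:Z - (l - (d j)%:Z) + (l - (d j)%:Z + e) by lia.
  exact: JM.
have [g] := J_rep (xw i0) (repX i0 wp); rewrite /pvar eqxx => Eg.
have [h] := J_rep (xw i1) (repX i1 wp).
rewrite /pvar eq_sym (negbTE i01) eqxx; exact: bivariate_divides Eg.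
Qed.

(** * Weighted homogeneous components of polynomials *)

Definition inner_weight : {poly k} -> {poly P} :=
  horner_eval ('X%:P%:P * 'X^(d i0)) \o map_poly (polyC \o polyC \o polyC).
HB.instance Definition _ := GRing.RMorphism.on inner_weight.

(* u |-> u t^(d i0), v |-> v t^(d i1) *)
Definition weight : P -> {poly P} :=
  horner_eval ('X%:P * 'X^(d i1)) \o map_poly inner_weight.
HB.instance Definition _ := GRing.RMorphism.on weight.

Lemma weightC c : weight c%:P = inner_weight c.
Proof. by rewrite /weight /= map_polyC horner_evalE hornerC. Qed.

Lemma weight_scal c : weight c%:P%:P = c%:P%:P%:P.
Proof. by rewrite weightC /inner_weight /= map_polyC horner_evalE hornerC. Qed.

Lemma weightX0 : weight 'X%:P = 'X%:P%:P * 'X^(d i0).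
Proof. by rewrite weightC /inner_weight /= map_polyX horner_evalE hornerX. Qed.

Lemma weightX1 : weight 'X = 'X%:P * 'X^(d i1).
Proof. by rewrite /weight /= map_polyX horner_evalE hornerX. Qed.

Lemma weight_pvar i : weight (pvar i) = (pvar i)%:P * 'X^(d i).
Proof.
rewrite /pvar; case: eqP => [->|_]; first exact: weightX0.
case: eqP => [->|_]; first exact: weightX1.
by rewrite rmorph0 mul0r.
Qed.

(** Representatives in degree e are weighted homogeneous of degree e, so that the coefficient of t^N
    in [weight] extracts the component of degree N. *)
Lemma rep_weight (e : nat) a p : rep e a p -> weight p = p%:P * 'X^e.
Proof.
(* In negative degrees p is 0, so the absolute value does no harm there. *)
suff H e' : rep e' a p -> weight p = p%:P * 'X^`|e'|%N by exact: H.
elim=> {e e' a p}.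
- by move=> c; rewrite weight_scal mulr1.
- by move=> e; rewrite rmorph0 mul0r.
- by move=> e a b p q _ Ep _ Eq; rewrite rmorphD /= Ep Eq polyCD mulrDl.
- move=> e i a p ap Ep; have [e0|e0] := ltP e 0.
    by rewrite (rep_neg ap e0) mulr0 rmorph0 mul0r.
  rewrite rmorphM /= weight_pvar Ep polyCM mulrACA -exprD.
  by congr (_ * 'X^_); lia.
Qed.

(** Surjectivity of A -> k[u, v]/(f), degree by degree: monomials in u and v lift to products of
    x_i0 and x_i1. *)
Lemma weight_coef_rep p (j : nat) : exists a, rep j a (weight p)`_j.
Proof.
have mulX i (q : {poly P}) : (forall j : nat, exists a, rep j a q`_j) ->
    forall j : nat, exists a, rep j a (q * ((pvar i)%:P * 'X^(d i)))`_j.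
  move=> H j'; rewrite mulrA coefMXn coefMC.
  case: ltnP => [_|dj]; first by exists 0; exact: rep0.
  have [a ap] := H (j' - d i)%N; exists (x i * a); rewrite mulrC.
  have -> : j'%:Z = (d i)%:Z + (j' - d i)%N by lia.
  exact: repX.
have repA (q q' : {poly P}) : (forall j : nat, exists a, rep j a q`_j) ->
    (forall j : nat, exists a, rep j a q'`_j) ->
    forall j : nat, exists a, rep j a (q + q')`_j.
  move=> H H' j'; have [a ap] := H j'; have [b bp] := H' j'.
  by exists (a + b); rewrite coefD; exact: repD.
have p0 : pvar i0 = 'X%:P by rewrite /pvar eqxx.
have p1 : pvar i1 = 'X by rewrite /pvar eq_sym (negbTE i01) eqxx.
elim/poly_ind: p j => [|p c IHp].
  by move=> j; rewrite rmorph0 coef0; exists 0; exact: rep0.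
rewrite rmorphD rmorphM /= weightX1 -p1; apply: (repA _ _ _); first exact: mulX.
elim/poly_ind: c => [|c c' IHc] j.
  by rewrite rmorph0 coef0; exists 0; exact: rep0.
rewrite polyCD polyCM rmorphD rmorphM /= weightX0 -p0 weight_scal.
move: j; apply: repA; first exact: mulX.
move=> [|j']; rewrite coefC /=; first by exists c'%:A; exact: rep_scal.
by exists 0; exact: rep0.
Qed.

(** * Syzygies of homogeneous elements of A *)

Section Syzygies.
Variables (m : nat) (g : 'I_m -> A) (eps : 'I_m -> nat).

Definition syzygy (e : int) (c : 'I_m -> A) :=
  (forall i, reg_deg (e - (eps i)%:Z) (c i)) /\ \sum_i g i * c i = 0.

Lemma syzygies_mod_J : exists r (t : 'I_r -> int) (kap : 'I_r -> 'I_m -> A),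
  (forall j, syzygy (t j) (kap j)) /\
  forall e c, syzygy e c -> exists2 a : 'I_r -> A,
    forall j, reg_deg (e - t j) (a j) &
    forall i, J (e - (eps i)%:Z) (c i - \sum_j kap j i * a j).
Proof.
pose S (p : 'rV[P]_m) := exists e c,
  syzygy e c /\ forall i, rep (e - (eps i)%:Z) (c i) (p 0 i).
have [r [B [SB BP]]] :=
  noetherian_rows S (poly_noetherian (poly_noetherian (@field_noetherian k))).
have /choice[t /choice[kap kapP]] := SB.
exists r, t, kap; split=> [j|e c [c_deg gc]]; first by have [] := kapP j.
have /choice[p pP] i : exists p, rep (e - (eps i)%:Z) (c i) p.
  by apply: rep_exists.
have [|q qE] := BP (\row_i p i).
  by exists e, c; split=> // i; rewrite mxE.
(* The component of degree e - t_j of the coefficient q_j. Since p_i and B_ji are homogeneous,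
   comparing coefficients of t^N shows that Q may replace q. *)
pose Q j : P := if e - t j is Posz N then (weight (q 0 j))`_N else 0.
have /choice[a aQ] j : exists a, rep (e - t j) a (Q j).
  rewrite /Q; case: (e - t j) => N; first exact: weight_coef_rep.
  by exists 0; exact: rep0.
exists a => [j|i]; first exact: rep_deg (aQ j).
have kap_rep j : rep (t j - (eps i)%:Z) (kap j i) (B j i).
  by have [_ /(_ i)] := kapP j; rewrite mxE.
have ra : rep (e - (eps i)%:Z) (\sum_j kap j i * a j) (\sum_j B j i * Q j).
  apply: rep_sum => j.
  have -> : e - (eps i)%:Z = t j - (eps i)%:Z + (e - t j) by lia.
  exact: repM.
suff E : p i = \sum_j B j i * Q j.
  exists 0; last by exists 0; rewrite mulr0.
  by rewrite -(subrr (p i)) {2}E; exact: repB.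
have [e0|e0] := ltP (e - (eps i)%:Z) 0.
  by rewrite (rep_neg (pP i) e0) (rep_neg ra e0).
have [N EN] : exists N : nat, e - (eps i)%:Z = N.
  by exists `|e - (eps i)%:Z|%N; lia.
have := pP i; rewrite EN => /rep_weight pw.
have := congr1 (fun M : 'rV_m => (weight (M 0 i))`_N) qE.
rewrite /= !mxE pw coefCM coefXn eqxx mulr1 => ->.
rewrite rmorph_sum coef_sum; apply: eq_bigr => j _.
rewrite mulrC rmorphM /=.
have [t0|t0] := ltP (t j - (eps i)%:Z) 0.
  by rewrite (rep_neg (kap_rep j) t0) rmorph0 !mul0r coef0.
have [M EM] : exists M : nat, t j - (eps i)%:Z = M.
  by exists `|t j - (eps i)%:Z|%N; lia.
have := kap_rep j; rewrite EM => /rep_weight->.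
rewrite -mulrA coefCM coefXnM /Q; congr (_ * _).
case E : (e - t j) => [N'|N']; last by rewrite ifT //; lia.
rewrite ifF; last by lia.
by congr nth; lia.
Qed.

Hypothesis g_deg : forall i, reg_deg (eps i) (g i).

(* Nakayama: K meets (A^m)J in KJ, by flatness of J. *)
Lemma syzygies_fingen : exists r (t : 'I_r -> int) (kap : 'I_r -> 'I_m -> A),
  (forall j, syzygy (t j) (kap j)) /\
  forall e c, syzygy e c -> exists a : 'I_r -> A,
    forall i, c i = \sum_j kap j i * a j.
Proof.
have [r [t [kap [kapP genP]]]] := syzygies_mod_J.
exists r, t, kap; split=> // e.
have [N] : exists N : nat, e < N%:Z by exists `|e|.+1%N; lia.
elim: N e => [|N IH] e eN c cP.
  exists (fun=> 0) => i; rewrite big1 => [|j _]; last by rewrite mulr0.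
  by apply: reg_deg_neg (proj1 cP i); lia.
have [a a_deg aJ] := genP e c cP.
pose c' : 'cV[A]_m := \col_i (c i - \sum_j kap j i * a j).
pose G : 'rV[A]_m := \row_i g i.
(* The remainder c' is a syzygy with entries in J, so the equational criterion writes it as h v,
   where the columns of h are syzygies and v has entries in J. *)
have [|||r' [t' [h [v [hP vJ cE Gh]]]]] :=
  trivial_relation D J_deg J0 JD JM J_socle (e := e) (q := fun i => e - (eps i)%:Z)
    (a := G) (c := c').
- by move=> i j; rewrite mxE; have -> : e - (e - (eps j)%:Z) = eps j by lia.
- by move=> i; rewrite mxE.
- apply/matrixP => i j; rewrite !mxE.
  transitivity (\sum_i g i * c i - \sum_j (\sum_i g i * kap j i) * a j).
    under [X in _ - X]eq_bigr do rewrite mulr_suml.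
    rewrite exchange_big -sumrB; apply: eq_bigr => s _; rewrite !mxE mulrBr.
    by congr (_ - _); rewrite mulr_sumr; apply: eq_bigr => z _; rewrite mulrA.
  rewrite (proj2 cP) big1 ?subrr // => s _.
  by rewrite (proj2 (kapP s)) mul0r.
have /choice[b bE] s : exists b : 'I_r -> A,
    forall i, h i s * v s 0 = \sum_j kap j i * b j.
  (* If t'_s <= 0 then v_s = 0, as J lies in positive degrees. Otherwise column s of h is a syzygy
     of degree e - t'_s < e. *)
  have [ts|ts] := leP (t' s) 0.
    have vs0 : v s 0 = 0.
      have [t0|t0] := ltP (t' s) 0; first exact: reg_deg_neg t0 (J_deg (vJ s)).
      have := vJ s; have -> : t' s = 0 by lia.
      move=> Js; have [z vz] := reg_deg0P (J_deg Js).
      by move: Js; rewrite vz => /J_scal->; rewrite scale0r.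
    by exists (fun=> 0) => i; rewrite vs0 mulr0 big1 // => j _; rewrite mulr0.
  have [||b bE] := IH (e - t' s) _ (fun i => h i s); first by lia.
    split=> [i|]; first by rewrite addrAC; exact: hP.
    have /rowP/(_ s) := Gh; rewrite mxE [RHS]mxE => Ghs; rewrite -[RHS]Ghs.
    by apply: eq_bigr => i _; rewrite mxE.
  exists (fun j => b j * v s 0) => i; rewrite bE mulr_suml.
  by under eq_bigr do rewrite -mulrA.
exists (fun j => a j + \sum_s b s j) => i.
transitivity (\sum_j kap j i * a j + \sum_s \sum_j kap j i * b s j); last first.
  rewrite exchange_big -big_split; apply: eq_bigr => j _.
  by rewrite mulrDr mulr_sumr.
have := congr1 (fun M : 'cV_m => M i 0) cE; rewrite !mxE => /eqP.
rewrite subr_eq addrC => /eqP->; congr (_ + _).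
by apply: eq_bigr => s _; rewrite bE.
Qed.

End Syzygies.

End Abelianization.

(** * Graded modules *)

Section DirectSum.
Variables (I : eqType) (V : zmodType) (S : I -> V -> Prop).

(** For kernels, free modules and shifts, additive projectors are easier to exhibit than uniqueness
    of decompositions. *)
Lemma direct_sum_intro (pr : I -> V -> V) :
  (forall i, S i 0) -> (forall i x y, S i x -> S i y -> S i (x - y)) ->
  (forall i, {morph pr i : x y / x + y}) ->
  (forall i x, S i (pr i x)) ->
  (forall i j x, S i x -> pr j x = if j == i then x else 0) ->
  (forall x, exists s, x = \sum_(i <- s) pr i x) -> direct_sum S.
Proof.
move=> S0 SB prD prS prE prsum; split=> [i|x|s f us fS f0 i si].
- by split; [exact: S0 | exact: SB].
- by have [s xE] := prsum x; exists s, (pr^~ x).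
have pr0 j : pr j 0 = 0 by rewrite (prE j) ?if_same.
have := congr1 (pr i) f0; rewrite pr0 (big_morph (pr i) (prD i) (pr0 i)).
rewrite (bigD1_seq i) //= (prE i) // eqxx big1 ?addr0 // => j /negbTE ji.
by rewrite (prE j) // eq_sym ji.
Qed.

Hypothesis dS : direct_sum S.

Let S0 i : S i 0. Proof. by have [/(_ i)[]] := dS. Qed.
Let SB i x y : S i x -> S i y -> S i (x - y).
Proof. by have [/(_ i)[_ H] _ _] := dS; apply: H. Qed.
Let SD i x y : S i x -> S i y -> S i (x + y).
Proof.
by move=> ? ?; rewrite -[y]opprK; apply: SB => //; rewrite -sub0r; exact: SB.
Qed.

(** The list s only bounds the support, so that two decompositions can be compared over a common
    list. *)
Definition decomposition x (f : I -> V) := (forall i, S i (f i)) /\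
  exists s : seq I, forall t, uniq t -> {subset s <= t} -> x = \sum_(i <- t) f i.

Lemma decomposition_exists x : exists f, decomposition x f.
Proof.
have [_ /(_ x)[s [f [fS ->]]] _] := dS.
(* The list in [direct_sum] may repeat an index; the multiplicity absorbs the repetitions. *)
exists (fun i => f i *+ count_mem i s); split=> [i|].
  by elim: (count _ s) => [|n IH]; rewrite ?mulr0n // mulrS; exact: SD.
exists s => t ut st.
transitivity (\sum_(i <- undup s) f i *+ count_mem i s).
  by rewrite big_undup_iterop_count; apply: eq_bigr.
rewrite [RHS](bigID (mem s)) /= [X in _ = _ + X]big1 ?addr0 => [|i]; last first.
  by move/count_memPn->.
rewrite -[RHS]big_filter; apply: perm_big; apply: uniq_perm.
- exact: undup_uniq.
- exact: filter_uniq.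
by move=> i; rewrite mem_undup mem_filter; case: (boolP (i \in s)) => // /st->.
Qed.

Lemma decompositionB x y f g : decomposition x f -> decomposition y g ->
  decomposition (x - y) (fun i => f i - g i).
Proof.
move=> [fS [s fs]] [gS [t gt]]; split=> [i|]; first exact: SB.
exists (s ++ t) => u uu stu; rewrite sumrB -fs -?gt // => i it; apply: stu.
  by rewrite mem_cat it orbT.
by rewrite mem_cat it.
Qed.

Lemma decomposition0 f : decomposition 0 f -> forall i, f i = 0.
Proof.
move=> [fS [s fs]] i; have [_ _] := dS.
apply; [exact: (undup_uniq (i :: s)) | exact: fS | | ].
  by rewrite -fs ?undup_uniq // => j js; rewrite mem_undup inE js orbT.
by rewrite mem_undup mem_head.
Qed.

Definition dproj i x : V := projT1 (cid (decomposition_exists x)) i.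

Lemma dproj_dec x : decomposition x (dproj^~ x).
Proof. by rewrite /dproj; case: cid. Qed.

Lemma dproj_unique x f i : decomposition x f -> dproj i x = f i.
Proof.
move=> xf; have := decompositionB (dproj_dec x) xf.
by rewrite subrr => /decomposition0/(_ i)/eqP; rewrite subr_eq0 => /eqP.
Qed.

Lemma dproj_in i x : S i (dproj i x).
Proof. by have [] := dproj_dec x. Qed.

Lemma dprojB i : {morph dproj i : x y / x - y}.
Proof.
move=> x y; apply: (@dproj_unique _ (fun i => dproj i x - dproj i y)).
by apply: decompositionB; exact: dproj_dec.
Qed.

Lemma dproj0 i : dproj i 0 = 0.
Proof. by have := dprojB i 0 0; rewrite !subrr. Qed.

Lemma dprojD i : {morph dproj i : x y / x + y}.
Proof.
by move=> x y; rewrite -[y in LHS]opprK dprojB -[- y]sub0r dprojB dproj0 sub0r opprK.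
Qed.

Lemma dproj_hom i j x : S i x -> dproj j x = if j == i then x else 0.
Proof.
move=> xi; apply: (@dproj_unique x (fun j => if j == i then x else 0)).
split=> [i'|]; first by case: eqP => [->|].
exists [:: i] => t ut it; rewrite (bigD1_seq i) ?it ?mem_head //= eqxx.
by rewrite big1 ?addr0 // => i' /negbTE->.
Qed.

End DirectSum.

Section GradedModules.
Variables (k : fieldType) (A : gralg k).
Implicit Types M N P : gmod A.

Lemma gdeg0 M i : gdeg i (0 : M).
Proof. by have [/(_ i)[]] := gdeg_direct M. Qed.

Lemma gdegB M i (x y : M) : gdeg i x -> gdeg i y -> gdeg i (x - y).
Proof. by have [/(_ i)[_ H] _ _] := gdeg_direct M; apply: H. Qed.

Lemma gdegD M i (x y : M) : gdeg i x -> gdeg i y -> gdeg i (x + y).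
Proof.
move=> ? ?; rewrite -[y]opprK -[- y]sub0r; do !apply: gdegB => //; exact: gdeg0.
Qed.

Lemma gdeg_sum M i (I : Type) (r : seq I) (F : I -> M) :
  (forall s, gdeg i (F s)) -> gdeg i (\sum_(s <- r) F s).
Proof.
by move=> FP; elim/big_rec: _ => [|s x _]; [exact: gdeg0 | exact: gdegD].
Qed.

Lemma gdeg_actZ M i j (x : M) (a : A) :
  gdeg i x -> reg_deg j a -> gdeg (i + j) (x <* a).
Proof.
case: j => j xi aj; first exact: gdeg_act.
by rewrite [a]aj /ract scale0r; exact: gdeg0.
Qed.

Definition component M i (x : M) : M := dproj (gdeg_direct M) i x.

Lemma component_in M i (x : M) : gdeg i (component i x).
Proof. exact: dproj_in. Qed.

Lemma component_sum M (x : M) : exists s : seq int, x = \sum_(i <- s) component i x.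
Proof.
have [_ [s xs]] := dproj_dec (gdeg_direct M) x; exists (undup s).
by apply: xs => [|i]; [exact: undup_uniq | rewrite mem_undup].
Qed.

Lemma component_hom M i j (x : M) :
  gdeg i x -> component j x = if j == i then x else 0.
Proof. exact: dproj_hom. Qed.

Lemma deg_map_component M N (f : {linear M -> N}) j i x : deg_map j f ->
  f (component i x) = component (i + j) (f x).
Proof.
move=> fj; have [_ [s xs]] := dproj_dec (gdeg_direct M) x.
rewrite -{1}[i](addrK j); apply/esym.
apply: (@dproj_unique _ _ _ _ _ (fun z => f (component (z - j) x))); split=> [z|].
  by rewrite -{1}[z](subrK j); apply: fj; exact: component_in.
exists [seq z + j | z <- s] => t ut st.
rewrite -linear_sum -(big_map (fun z => z - j) xpredT (fun z => component z x)) -xs //.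
  by rewrite map_inj_uniq //; exact: addIr.
by move=> z zs; apply/mapP; exists (z + j); rewrite ?addrK //; apply/st/map_f.
Qed.

Definition mklinear (R : pzRingType) (U V : lmodType R) (f : U -> V)
  (lf : linear f) : {linear U -> V} :=
  HB.pack f (GRing.isLinear.Build R U V *:%R f lf).

End GradedModules.

Lemma ract_linear (k : fieldType) (A : gralg k) (M N : gmod A) (f : {linear M -> N})
  (x : M) (a : A) : f (x <* a) = f x <* a.
Proof. exact: linearZ. Qed.

Lemma ractA (k : fieldType) (A : gralg k) (M : gmod A) (x : M) (a b : A) :
  x <* a <* b = x <* (a * b).
Proof. by rewrite /ract scalerA. Qed.

Section Kernel.
Variables (k : fieldType) (A : gralg k) (M N : gmod A) (f : {linear M -> N}).

Definition in_kernel : {pred M} := fun x => f x == 0.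

Fact in_kernel_submod : submod_closed in_kernel.
Proof.
split=> [|a x y]; rewrite !unfold_in ?linear0 // => /eqP fx /eqP fy.
by rewrite linearP fx fy scaler0 addr0.
Qed.
HB.instance Definition _ := GRing.isSubmodClosed.Build _ _ in_kernel in_kernel_submod.

Record kernel := Kernel { kval : M; kvalP : kval \in in_kernel }.
HB.instance Definition _ := [isSub for kval].
HB.instance Definition _ := [Choice of kernel by <:].
HB.instance Definition _ := [SubChoice_isSubLmodule of kernel by <:].

Hypothesis f_deg : deg_map 0 f.

Definition kernel_deg i (x : kernel) := gdeg i (kval x).

Lemma kval_linear : linear kval.
Proof. exact: (linearP (val : {linear kernel -> M})). Qed.

Lemma f_kval x : f (kval x) = 0.
Proof. exact/eqP/(kvalP x). Qed.

Lemma kernel_component i (x : kernel) : component i (kval x) \in in_kernel.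
Proof.
rewrite unfold_in (deg_map_component _ _ f_deg) f_kval.
by rewrite /component dproj0.
Qed.

Lemma kernel_direct : direct_sum kernel_deg.
Proof.
apply: (@direct_sum_intro _ _ _ (fun i x => Kernel (kernel_component i x))).
- by move=> i; rewrite /kernel_deg; exact: gdeg0.
- by move=> i x y; exact: gdegB.
- by move=> i x y; apply: val_inj; exact: dprojD.
- by move=> i x; exact: component_in.
- move=> i j x xi; apply: val_inj; rewrite /=.
  by rewrite (component_hom _ (xi : gdeg i (kval x))); case: ifP.
- move=> x; have [s xs] := component_sum (kval x).
  by exists s; apply: val_inj; rewrite raddf_sum /= [LHS]xs.
Qed.

Lemma kernel_act i j (x : kernel) (a : A) :
  kernel_deg i x -> gr j a -> kernel_deg (i + j%:Z) (x <* a).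
Proof. by move=> xi aj; exact: (@gdeg_act _ _ M). Qed.

Definition ker_gmod : gmod A := GMod kernel_direct kernel_act.

Definition ker_incl : {linear ker_gmod -> M} := mklinear kval_linear.

Lemma ker_incl_deg : deg_map 0 ker_incl.
Proof. by move=> i x xi; rewrite addr0. Qed.

Lemma ker_incl_inj : injective ker_incl.
Proof. exact: val_inj. Qed.

Lemma f_ker_incl x : f (ker_incl x) = 0.
Proof. exact: f_kval. Qed.

Lemma ker_inclP x : f x = 0 -> exists y, ker_incl y = x.
Proof. by move=> /eqP fx; exists (Kernel fx). Qed.

Lemma ker_lift (P : gmod A) (g : {linear P -> M}) : deg_map 0 g ->
  (forall x, f (g x) = 0) ->
  exists2 h : {linear P -> ker_gmod}, deg_map 0 h & forall x, ker_incl (h x) = g x.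
Proof.
move=> gd fg; pose h x : ker_gmod := Kernel (introT eqP (fg x)).
have lh : linear h by move=> a x y; apply: val_inj; exact: linearP.
by exists (mklinear lh) => // i x /gd.
Qed.

End Kernel.

Section Modules.
Variables (k : fieldType) (A : gralg k).

(** [projective] lifts through surjections only; p becomes one when its target is cut down to the
    kernel of q. *)
Lemma projective_lift (P L M N : gmod A) (p : {linear L -> M}) (q : {linear M -> N})
    (f : {linear P -> M}) :
  projective P -> deg_map 0 p -> deg_map 0 q -> deg_map 0 f ->
  (forall x, q (p x) = 0) -> (forall x, q x = 0 -> exists y, p y = x) ->
  (forall x, q (f x) = 0) ->
  exists2 g : {linear P -> L}, deg_map 0 g & forall x, p (g x) = f x.
Proof.
move=> projP pd qd fd qp ex qf.
have [p' p'd p'E] := ker_lift qd pd qp.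
have [f' f'd f'E] := ker_lift qd fd qf.
have [|g gd gE] := projP _ _ p' f' p'd _ f'd.
  move=> y; have [x xE] := ex _ (f_ker_incl y); exists x.
  by apply: (ker_incl_inj (f_deg := qd)); rewrite p'E.
by exists g => // x; rewrite -p'E gE f'E.
Qed.

Lemma deg_map_surj (M N : gmod A) (p : {linear M -> N}) i y :
  deg_map 0 p -> (exists x, p x = y) -> gdeg i y -> exists2 x, gdeg i x & p x = y.
Proof.
move=> pd [x xy] yi; exists (component i x); first exact: component_in.
by rewrite (deg_map_component _ _ pd) addr0 xy (component_hom _ yi) eqxx.
Qed.

Lemma basis_projective (P : gmod A) n (g : 'I_n -> P) (e : 'I_n -> int)
    (crd : P -> 'I_n -> A) :
  (forall i, gdeg (e i) (g i)) ->
  (forall (a : A) x y i, crd (x <* a + y) i = crd x i * a + crd y i) ->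
  (forall x, x = \sum_i g i <* crd x i) ->
  (forall i j x, gdeg j x -> reg_deg (j - e i) (crd x i)) -> projective P.
Proof.
move=> g_deg crdP crdE crd_deg M N p f pd ps fd.
have /choice[m mP] i : exists m, gdeg (e i) m /\ p m = f (g i).
  have [||m mi me] := @deg_map_surj M N p (e i) (f (g i)) pd; last by exists m.
    exact: ps.
  by rewrite -[e i]addr0; exact: fd.
pose h x := \sum_i m i <* crd x i.
have lh : linear h.
  move=> a x y; rewrite /h scaler_sumr -big_split; apply: eq_bigr => i _ /=.
  by rewrite (crdP a) /ract scalerDl scalerA.
exists (mklinear lh) => [j x xj|x].
  apply: gdeg_sum => i; rewrite addr0 -[j](subrK (e i)) addrC.
  by apply: gdeg_actZ; [have [] := mP i | exact: crd_deg].
rewrite /= /h linear_sum [in RHS](crdE x) linear_sum.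
by apply: eq_bigr => i _; rewrite !ract_linear; have [_ ->] := mP i.
Qed.

Lemma reg_projective : projective (reg_gmod A).
Proof.
apply: (@basis_projective (reg_gmod A) 1 (fun=> 1 : A) (fun=> 0) (fun x _ => x)).
- by move=> _; apply/gr_connected; exists 1; rewrite scale1r.
- by [].
- by move=> x; rewrite big_ord1 /ract [LHS](esym (mul1r (x : A))).
- by move=> _ j x; rewrite subr0.
Qed.

Section Free.
Variables (n : nat) (e : 'I_n -> int).

Definition free_car : Type := {ffun 'I_n -> (galg A)^c^o}.
HB.instance Definition _ := GRing.Lmodule.on free_car.

Definition free_deg i (x : free_car) := forall j, reg_deg (i - e j) (x j : A).

Lemma free_direct : direct_sum free_deg.
Proof.
pose pr i (x : free_car) : free_car :=
  [ffun j => component (M := reg_gmod A) (i - e j) (x j)].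
apply: (@direct_sum_intro _ _ _ pr).
- by move=> i j; rewrite ffunE; exact: reg_deg0.
- by move=> i x y xi yi j; rewrite !ffunE; exact: reg_degB.
- by move=> i x y; apply/ffunP => j; rewrite !ffunE; exact: dprojD.
- by move=> i x j; rewrite ffunE; exact: (component_in (M := reg_gmod A)).
- move=> i j x xi; apply/ffunP => z; rewrite ffunE.
  rewrite (component_hom (M := reg_gmod A) _ (xi z)).
  by rewrite (inj_eq (addIr _)); case: eqP => // _; rewrite ffunE.
- move=> x; have /choice[s sP] j : exists s : seq int, forall t : seq int, uniq t ->
      {subset s <= t} -> x j = \sum_(i <- t) component (M := reg_gmod A) i (x j).
    by have [_] := dproj_dec (gdeg_direct (reg_gmod A)) (x j).
  exists (undup (flatten [seq [seq i + e j | i <- s j] | j <- enum 'I_n])).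
  apply/ffunP => j; rewrite sum_ffunE.
  set t := undup _; have ut : uniq t by exact: undup_uniq.
  rewrite {1}(sP j [seq i - e j | i <- t]); first last.
  - move=> i isj; apply/mapP; exists (i + e j); last by rewrite addrK.
    rewrite mem_undup; apply/flattenP; exists [seq i + e j | i <- s j].
      by apply: map_f; rewrite mem_enum.
    exact: map_f.
  - by rewrite map_inj_uniq //; exact: addIr.
  by rewrite big_map; apply: eq_bigr => i _; rewrite ffunE.
Qed.

Lemma free_act i j (x : free_car) (a : A) :
  free_deg i x -> gr j a -> free_deg (i + j%:Z) (x <* a).
Proof.
move=> xi aj z; rewrite ffunE addrAC.
exact: (reg_degM (xi z) (aj : reg_deg j a)).
Qed.

Definition free_gmod : gmod A := GMod free_direct free_act.

Definition free_gen (i : 'I_n) : free_gmod := [ffun j => (i == j)%:R : A].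

Lemma free_gen_deg i : gdeg (e i) (free_gen i).
Proof.
move=> j; rewrite ffunE; case: eqP => [->|_]; last exact: reg_deg0.
by rewrite subrr -[_%:R]scale1r; exact: reg_deg1.
Qed.

Lemma free_genE (x : free_gmod) : x = \sum_i free_gen i <* (x : {ffun _ -> _}) i.
Proof.
apply/ffunP => j; rewrite sum_ffunE (bigD1 j) //= big1 => [|i ij].
  rewrite addr0 !ffunE eqxx; exact: (esym (@mulr1 (galg A)^c (x j))).
by rewrite !ffunE (negbTE ij); exact: (@mulr0 (galg A)^c).
Qed.

Lemma free_projective : projective free_gmod.
Proof.
apply: (@basis_projective free_gmod n free_gen e (fun x i => x i)).
- exact: free_gen_deg.
- by move=> a x y i; rewrite !ffunE.
- exact: free_genE.
- by move=> i j x; exact.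
Qed.

Lemma free_map_ex (M : gmod A) (m : 'I_n -> M) : (forall i, gdeg (e i) (m i)) ->
  exists2 f : {linear free_gmod -> M}, deg_map 0 f &
    forall x : free_gmod, f x = \sum_i m i <* (x : {ffun _ -> _}) i.
Proof.
move=> m_deg; pose f (x : free_gmod) := \sum_i m i <* (x : {ffun _ -> _}) i.
have lf : linear f.
  move=> a x y; rewrite /f scaler_sumr -big_split; apply: eq_bigr => i _ /=.
  by rewrite /ract !ffunE scalerDl scalerA.
exists (mklinear lf) => // j x xj; apply: gdeg_sum => i.
by rewrite addr0 -[j](subrK (e i)) addrC; apply: gdeg_actZ.
Qed.

End Free.

Section Shift.
Variables (M : gmod A) (s : int).

(** Shifting turns maps of degree j into maps of degree 0, which are the ones that [projective]
    lifts. *)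
Definition shift_deg i (x : M) := gdeg (i + s) x.

Lemma shift_direct : direct_sum shift_deg.
Proof.
apply: (@direct_sum_intro _ _ _ (fun i x => component (i + s) x)).
- by move=> i; exact: gdeg0.
- by move=> i x y; exact: gdegB.
- by move=> i x y; exact: dprojD.
- by move=> i x; exact: component_in.
- move=> i j x xi; rewrite (component_hom _ (xi : gdeg (i + s) (x : M))).
  by rewrite (inj_eq (addIr s)).
- move=> x; have [t xt] := component_sum (x : M).
  exists [seq i - s | i <- t]; rewrite big_map.
  by under eq_bigr => i _ do rewrite subrK.
Qed.

Lemma shift_act i j (x : M) (a : A) :
  shift_deg i x -> gr j a -> shift_deg (i + j%:Z) (x <* a).
Proof. by move=> xi aj; rewrite /shift_deg addrAC; exact: gdeg_act. Qed.

Definition shift_gmod : gmod A := GMod shift_direct shift_act.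

End Shift.

End Modules.

(** * Coherence *)

Section Coherent.
Variables (k : fieldType) (A : gralg k).

Lemma homogeneous_generators (I : A -> Prop) p (g0 : 'I_p -> A) :
  homogeneous I -> (forall j, I (g0 j)) ->
  exists m (eps : 'I_m -> nat) (g : 'I_m -> A),
    (forall i, gr (eps i) (g i) /\ I (g i)) /\
    forall j, exists c : 'I_m -> A, g0 j = \sum_i g i * c i.
Proof.
move=> homI; elim: p g0 => [|p IH] g0 g0I.
  by exists 0%N, (fun=> 0%N), (fun=> 0); split=> -[].
have [m [eps [g [gP gE]]]] := IH (fun j => g0 (lift ord0 j)) (fun j => g0I _).
have [s [f [fP fE]]] := homI _ (g0I ord0).
exists (size s + m)%N,
  (fun i => match split i with inl i => nth 0%N s i | inr i => eps i end),
  (fun i => match split i with inl i => f (nth 0%N s i) | inr i => g i end).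
split=> [i|j]; first by case: split.
have [j'|] := unliftP ord0 j => ->.
  have [c ->] := gE j'.
  exists (fun i => match split i with inl _ => 0 | inr i => c i end).
  rewrite big_split_ord /= [X in _ = X + _]big1 ?add0r => [|i _].
    by apply: eq_bigr => i _; rewrite (unsplitK (inr i)).
  by rewrite (unsplitK (inl i)) mulr0.
exists (fun i => match split i with inl _ => 1 | inr i => 0 end).
rewrite big_split_ord /= [X in _ = _ + X]big1 ?addr0 => [|i _].
  rewrite fE (big_nth 0%N) big_mkord; apply: eq_bigr => i _.
  by rewrite (unsplitK (inl i)) mulr1.
by rewrite (unsplitK (inr i)) mulr0.
Qed.

(** The syzygies are the kernel of a degree 0 map from a free module, and such a kernel is
    graded. *)
Lemma syzygy_decomposition m (eps : 'I_m -> nat) (g : 'I_m -> A) (c : 'I_m -> A) :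
  (forall i, reg_deg (eps i) (g i)) -> \sum_i g i * c i = 0 ->
  exists (s : seq int) (f : int -> 'I_m -> A),
    (forall e, syzygy g eps e (f e)) /\ forall i, c i = \sum_(e <- s) f e i.
Proof.
move=> g_deg gc.
have [del del_deg delE] := @free_map_ex k A m (fun i => (eps i)%:Z) (reg_gmod A) g g_deg.
pose x : free_gmod A (fun i => (eps i)%:Z) := [ffun i => c i : (galg A)^c^o].
have [z zx] : exists z, ker_incl del_deg z = x.
  apply: ker_inclP; rewrite delE -[RHS]gc; apply: eq_bigr => i _.
  by rewrite ffunE.
have [s zs] := component_sum z.
exists s, (fun e i => ker_incl del_deg (component e z) i); split=> [e|i].
  split=> [i|]; first exact: (component_in e z).
  have := f_ker_incl (component e z); rewrite delE => E; rewrite -[RHS]E.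
  exact: eq_bigr.
have xE : x = \sum_(e <- s) ker_incl del_deg (component e z).
  by rewrite -linear_sum -zs.
by have := congr1 (fun w : free_car A m => w i) xE; rewrite sum_ffunE ffunE.
Qed.

Lemma coherent_of_dim2_data n (d : 'I_n -> nat) (l : int) (x y : 'I_n -> A) :
  dim2_data d l x y -> (1 < n)%N -> graded_coherent A.
Proof.
move=> D n1 I [I0 ID IM] homI [p [g0 g0E]].
pose i0 := Ordinal (ltnW n1); pose i1 := Ordinal n1.
have /choice[Y YP] i : exists p, rep d x i0 i1 (l - (d i)%:Z) (y i) p.
  by apply: (rep_exists D _ (y_deg D i)).
have g0I j : I (g0 j).
  apply/g0E; exists (fun i => (i == j)%:R); rewrite (bigD1 j) //= big1 ?addr0.
    by rewrite eqxx /ract scale1r.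
  by move=> i /negbTE->; rewrite /ract scale0r.
have [m [eps [g [gP gE]]]] := homogeneous_generators homI g0I.
have g_deg i : reg_deg (eps i) (g i) by have [] := gP i.
have [r [t [kap [kapP kapE]]]] := syzygies_fingen D (isT : i0 != i1) YP g_deg.
exists m, r, (fun i => (eps i)%:Z), t, g, kap; split.
- exact: g_deg.
- move=> z; split=> [/g0E[c ->]|[c ->]].
    have /choice[b bE] := gE; exists (fun i => \sum_j b j i * c j).
    transitivity (\sum_j (\sum_i g i * b j i) * c j).
      by apply: eq_bigr => j _; rewrite -bE.
    under eq_bigr do rewrite mulr_suml.
    rewrite exchange_big; apply: eq_bigr => i _.
    rewrite [RHS](mulr_sumr _ _ _ (g i : A)); apply: eq_bigr => j _.
    by rewrite mulrA.
  elim/big_rec: _ => // i a _; apply: ID; apply: IM; by have [] := gP i.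
- by move=> j i; have [] := kapP j.
move=> c; split=> [gc|[b bE]].
  have [s [f [fP cE]]] := syzygy_decomposition g_deg gc.
  have /choice[b bE] e := kapE e (f e) (fP e).
  exists (fun j => \sum_(e <- s) b e j) => i.
  rewrite cE; under eq_bigr do rewrite bE.
  by rewrite exchange_big; apply: eq_bigr => j _; rewrite mulr_sumr.
transitivity (\sum_j (\sum_i g i * kap j i) * b j).
  under [RHS]eq_bigr do rewrite mulr_suml.
  rewrite exchange_big; apply: eq_bigr => i _.
  rewrite bE [LHS](mulr_sumr _ _ _ (g i : A)); apply: eq_bigr => j _.
  by rewrite mulrA.
by rewrite big1 // => j _; have [_ ->] := kapP j; rewrite mul0r.
Qed.

End Coherent.

(** * The minimal resolution of the trivial module *)

Section Schanuel.
Variables (k : fieldType) (A : gralg k).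

Lemma deg_map_comp (L M N : gmod A) (f : {linear M -> N}) (g : {linear L -> M}) :
  deg_map 0 f -> deg_map 0 g -> deg_map 0 (f \o g).
Proof. by move=> fd gd i x xi; have := fd _ _ (gd _ _ xi); rewrite !addr0. Qed.

Lemma deg_map_sub (M N : gmod A) (f g : {linear M -> N}) j :
  deg_map j f -> deg_map j g -> deg_map j (f \- g).
Proof. by move=> fd gd i x xi; apply: gdegB; [exact: fd | exact: gd]. Qed.

Lemma deg_map_id (M : gmod A) : deg_map 0 (idfun : {linear M -> M}).
Proof. by move=> i x; rewrite addr0. Qed.

(** Injectivity of p makes the pointwise lift unique, hence linear and homogeneous; P need not be
    projective. *)
Lemma injective_lift (P L M : gmod A) (p : {linear L -> M}) (f : {linear P -> M}) :
  deg_map 0 p -> deg_map 0 f -> (forall x, p x = 0 -> x = 0) ->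
  (forall x, exists y, p y = f x) ->
  exists2 g : {linear P -> L}, deg_map 0 g & forall x, p (g x) = f x.
Proof.
move=> pd fd pI /choice[g gE].
have pinj x y : p x = p y -> x = y.
  by move=> /eqP; rewrite -subr_eq0 -linearB => /eqP/pI/eqP; rewrite subr_eq0 => /eqP.
have lg : linear g.
  by move=> a x y; apply: pinj; rewrite gE !linearP /= !gE.
exists (mklinear lg) => // i x xi; rewrite addr0 /=.
suff -> : g x = component i (g x) by exact: component_in.
apply: pinj; rewrite (deg_map_component _ _ pd) gE addr0.
by rewrite (component_hom _ (fd _ _ xi)) addr0 eqxx.
Qed.

(* Schanuel: compare with a resolution R of length 2 by chain maps be : S -> R,
   al : R -> S and a homotopy h from al be to id; on the kernel this says
   id = al2 be2 + h1. *)
Lemma second_syzygy_projective (M S0 S1 : gmod A) (eps : {linear S0 -> M})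
    (del : {linear S1 -> S0}) (del_deg : deg_map 0 del) :
  projective S0 -> projective S1 -> deg_map 0 eps ->
  (forall y, exists x, eps x = y) -> (forall x, eps (del x) = 0) ->
  (forall x, eps x = 0 -> exists y, del y = x) -> pd_le M 2 ->
  projective (ker_gmod del_deg).
Proof.
move=> proj0 proj1 eps_deg eps_surj eps_del exact_S [R R0].
have R_diff0 x : raug R (rdiff R 0 x) = 0 by apply/(@rexact0 _ _ _ R); exists x.
have R_exact0 x : raug R x = 0 -> exists y, rdiff R 0 y = x.
  by move/(@rexact0 _ _ _ R) => [y ->]; exists y.
have R_inj x : rdiff R 1 x = 0 -> x = 0.
  by move/(@rexact _ _ _ R) => [y ->]; rewrite (R0 3%N isT y) linear0.
have [be0 be0d be0E] := proj0 _ _ _ _ (@raug_deg _ _ _ R) (@raug_surj _ _ _ R) eps_deg.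
have [||be1 be1d be1E] := projective_lift (p := rdiff R 0) (q := raug R)
  (f := be0 \o del) proj1 (@rdiff_deg _ _ _ R 0) (@raug_deg _ _ _ R) _ R_diff0 R_exact0.
- exact: deg_map_comp.
- by move=> x; rewrite /= be0E eps_del.
have [|be2 be2d be2E] := injective_lift (p := rdiff R 1)
  (f := be1 \o ker_incl del_deg) (@rdiff_deg _ _ _ R 1)
  (deg_map_comp be1d (@ker_incl_deg _ _ _ _ _ _)) R_inj.
  move=> x; have /(@rexact _ _ _ R)[y yE] : rdiff R 0 (be1 (ker_incl del_deg x)) = 0.
    by rewrite be1E /= f_ker_incl linear0.
  by exists y; rewrite -yE.
have [al0 al0d al0E] := @rproj _ _ _ R 0%N _ _ _ _ eps_deg eps_surj (@raug_deg _ _ _ R).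
have [||al1 al1d al1E] := projective_lift (p := del) (q := eps)
  (f := al0 \o rdiff R 0) (@rproj _ _ _ R 1) del_deg eps_deg _ eps_del exact_S.
- by apply: deg_map_comp => //; exact: rdiff_deg.
- by move=> x; rewrite /= al0E R_diff0.
have [||al2 al2d al2E] := ker_lift (g := al1 \o rdiff R 1) del_deg.
- by apply: deg_map_comp => //; exact: rdiff_deg.
- move=> x; rewrite /= al1E /=.
  have /(@rexact _ _ _ R)-> : exists y, rdiff R 1 x = rdiff R 1 y by exists x.
  by rewrite linear0.
have [||h0 h0d h0E] := projective_lift (p := del) (q := eps)
  (f := idfun \- (al0 \o be0)) proj0 del_deg eps_deg _ eps_del exact_S.
- by apply: deg_map_sub; [exact: deg_map_id | exact: deg_map_comp].
- by move=> x; rewrite /= linearB /= al0E be0E subrr.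
have [||h1 h1d h1E] := ker_lift (g := (idfun \- (al1 \o be1)) \- (h0 \o del)) del_deg.
- do 2![apply: deg_map_sub; last exact: deg_map_comp]; exact: deg_map_id.
- by move=> x; rewrite /= !linearB /= al1E /= be1E /= h0E /= subrr.
move=> L N p f pd ps fd.
have [g2 g2d g2E] := @rproj _ _ _ R 2%N _ _ _ (f \o al2) pd ps (deg_map_comp fd al2d).
have [g1 g1d g1E] := proj1 _ _ _ (f \o h1) pd ps (deg_map_comp fd h1d).
(* This is g2 be2 + g1 restricted to the kernel: both terms of the identity on the kernel factor
   through projectives, R 2 and S1. *)
pose g : {linear ker_gmod del_deg -> L} :=
  (g2 \o be2) \- ((\- g1) \o ker_incl del_deg).
exists g => [|x].
  apply: deg_map_sub; first exact: deg_map_comp.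
  move=> i x xi; rewrite /= -sub0r; apply: gdegB; first exact: gdeg0.
  by rewrite -[i]addr0; apply: g1d; apply: ker_incl_deg.
rewrite /g /= opprK linearD g2E g1E /= -linearD; congr (f _).
apply: (@ker_incl_inj _ _ _ _ _ del_deg); rewrite linearD al2E h1E /=.
by rewrite be2E /= f_ker_incl linear0 subr0 addrC subrK.
Qed.

End Schanuel.

(** * Ext^2 from a resolution of length two *)

Section ShortResolution.
Variables (k : fieldType) (A : gralg k) (M S0 S1 : gmod A).
Variables (eps : {linear S0 -> M}) (del : {linear S1 -> S0}).
Hypothesis del_deg : deg_map 0 del.
Let K := ker_gmod del_deg.
Hypothesis proj0 : projective S0.
Hypothesis proj1 : projective S1.
Hypothesis projK : projective K.
Hypothesis eps_deg : deg_map 0 eps.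
Hypothesis eps_surj : forall y, exists x, eps x = y.
Hypothesis exact_S : forall x, eps x = 0 <-> exists y, x = del y.

(** The kernel of an identity map serves as the zero module. *)
Let Z := ker_gmod (@deg_map_id k A K).

Let Z0 (x : Z) : x = 0.
Proof. exact/val_inj/(f_kval x). Qed.

Let zero_linear (L N : gmod A) : linear (fun _ : L => 0 : N).
Proof. by move=> a x y; rewrite scaler0 addr0. Qed.
Let zero_map (L N : gmod A) : {linear L -> N} := mklinear (@zero_linear L N).

Let zero_deg (L N : gmod A) : deg_map 0 (zero_map L N).
Proof. by move=> i x _; exact: gdeg0. Qed.

Definition short_mod (n : nat) : gmod A :=
  match n with 0 => S0 | 1 => S1 | 2 => K | _ => Z end.

Definition short_diff (n : nat) : {linear short_mod n.+1 -> short_mod n} :=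
  match n with
  | 0 => del | 1 => ker_incl del_deg | 2 => zero_map Z K | _ => zero_map Z Z
  end.

Fact short_proj n : projective (short_mod n).
Proof.
case: n => [|[|[|n]]] //= L N p f pd ps fd.
exists (zero_map Z L); first exact: zero_deg.
by move=> x; rewrite (Z0 x) !linear0.
Qed.

Fact short_deg n : deg_map 0 (short_diff n).
Proof.
case: n => [|[|[|n]]] /=; [exact: del_deg | exact: ker_incl_deg | exact: zero_deg..].
Qed.

Fact short_exact n (x : short_mod n.+1) :
  short_diff n x = 0 <-> exists y, x = short_diff n.+1 y.
Proof.
case: n x => [|[|n]] /= x.
- by split=> [/ker_inclP-/(_ del_deg)[y <-]|[y ->]]; [exists y | exact: f_ker_incl].
- split=> [x0|[y ->]]; last exact: (linear0 (ker_incl del_deg)).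
  exists 0; apply: (@ker_incl_inj _ _ _ _ _ del_deg).
  by apply: etrans x0 _; exact: (esym (linear0 (ker_incl del_deg))).
- by case: n x => [|n] x; split=> _ //; exists 0; exact: Z0.
Qed.

Definition short_resolution : resolution M :=
  Resolution short_proj short_deg eps_deg eps_surj exact_S short_exact.

(** In [short_resolution] every homogeneous map on K is a cocycle, so Ext^2(M, N) is the space of
    maps K -> N modulo these. *)
Definition extends (N : gmod A) (j : int) (f : K -> N) :=
  exists2 g : {linear S1 -> N}, deg_map j g & forall x, f x = g (ker_incl del_deg x).

Lemma Ext2_shift_vanish (N : gmod A) l j (f : {linear K -> N}) :
  Ext_iso 2 M N (shift_k k l) -> deg_map j f -> l + j <> 0 -> extends j f.
Proof.
move=> /(_ short_resolution j)[phi [_ _ phi0]] fj lj.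
have /phi0[+ _] : cocycle (R := short_resolution) (i := 2) j f.
  by split=> // y; rewrite /= linear0.
apply; move: (phi f); rewrite /shift_k.
by case: eqP => // _ v; rewrite (thinmx0 v).
Qed.

(** In degree -l, Ext^2 is one-dimensional and so spanned by the nonzero class of f. *)
Lemma Ext2_shift_line (N : gmod A) l (f g : {linear K -> N}) :
  Ext_iso 2 M N (shift_k k l) -> deg_map (- l) f -> deg_map (- l) g ->
  ~ extends (- l) f ->
  exists c : k, forall h : {linear K -> N}, deg_map (- l) h ->
    (forall x, h x = f x <* c%:A + g x) -> extends (- l) h.
Proof.
move=> /(_ short_resolution (- l))[phi [phiD _ phi0]] fl gl nf.
have coc (h : {linear K -> N}) : deg_map (- l) h ->
    cocycle (R := short_resolution) (i := 2) (- l) h.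
  by move=> hl; split=> // y; rewrite /= linear0.
have [c cE] : exists c, c *: phi f + phi g = 0.
  have pf : phi f <> 0 by move=> /(phi0 f (coc f fl)).
  move: (phi f) (phi g) pf; rewrite /shift_k subrr eqxx => u v /eqP u0.
  by exists (- v / u); rewrite -[_ *: _]/(_ * _) divfK // addNr.
exists c => h hl hE; apply/(phi0 h (coc h hl)).
by rewrite (phiD c f g h) //; exact: coc.
Qed.

(** If K were 0, every map on it would extend by 0, whereas Ext^2 is k in degree -l. *)
Lemma Ext2_shift_nonzero (N : gmod A) l :
  Ext_iso 2 M N (shift_k k l) -> exists x : K, x <> 0.
Proof.
move=> /(_ short_resolution (- l))[phi [_ phis phi0]].
apply: contrapT => nK.
have K0 x : x = 0 :> K by apply: contrapT => x0; apply: nK; exists x.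
have [e e0] : exists e : shift_k k l (- l), e <> 0.
  by rewrite /shift_k subrr eqxx; exists 1; exact/eqP/oner_neq0.
have [f fc fe] := phis e; apply: e0; rewrite -fe; apply/phi0 => //=.
exists (zero_map S1 N) => [i x _|x]; first exact: gdeg0.
by rewrite [x]K0 linear0.
Qed.

End ShortResolution.

(** * Linear forms on graded modules *)

Section Functional.
Variables (k : fieldType) (A : gralg k) (P : gmod A).

Definition subspace (W : P -> Prop) :=
  W 0 /\ forall (c : k) u v, W u -> W v -> W (u <* c%:A + v).

Lemma ract0 (M : gmod A) (a : A) : (0 : M) <* a = 0.
Proof. by rewrite /ract scaler0. Qed.

Lemma ractDl (M : gmod A) (x y : M) (a : A) : (x + y) <* a = x <* a + y <* a.
Proof. by rewrite /ract scalerDr. Qed.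

Lemma ractDr (M : gmod A) (x : M) (a b : A) : x <* (a + b) = x <* a + x <* b.
Proof. by rewrite /ract scalerDl. Qed.

Lemma ract_scal (M : gmod A) (x : M) (c c' : k) :
  x <* c%:A <* c'%:A = x <* (c * c')%:A.
Proof. by rewrite ractA mulr_algl scalerA. Qed.

Lemma ract1 (M : gmod A) (x : M) : x <* 1 = x.
Proof. by rewrite /ract scale1r. Qed.

Lemma ractN (M : gmod A) (x : M) (a : A) : x <* (- a) = - (x <* a).
Proof. by rewrite /ract scaleNr. Qed.

(** A maximal subspace U that contains W and avoids z has codimension 1; the form is the coordinate
    along z modulo U. *)
Lemma linear_form (W : P -> Prop) (z : P) : subspace W -> ~ W z ->
  exists lam : P -> k, [/\ forall c u v, lam (u <* c%:A + v) = lam u * c + lam v,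
    lam z = 1 & forall w, W w -> lam w = 0].
Proof.
move=> [W0 WP] Wz.
(* Adjoining W here lets the empty chain of Zorn's lemma, whose union is empty, pass the test. *)
pose good (L : set P) := [/\ subspace (fun x => W x \/ L x), ~ L z & True].
have [L [Lgood Lmax]] : exists L,
    good L /\ forall L', (L `<` L')%classic -> ~ good L'.
  apply: Zorn_bigcup => F FP Ftot; split=> //; last first.
    by move=> [X FX Xz]; have [_ /(_ Xz)] := FP _ FX.
  split; first by left.
  move=> c u v [Wu|[X FX Xu]] [Wv|[Y FY Yv]].
  - by left; exact: WP.
  - have [[_ /(_ c u v)H] _ _] := FP _ FY.
    by have [||?|?] := H; [left | right | left | right; exists Y].
  - have [[_ /(_ c u v)H] _ _] := FP _ FX.
    by have [||?|?] := H; [right | left | left | right; exists X].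
  - have [XY|YX] := Ftot _ _ FX FY.
      have [[_ /(_ c u v)H] _ _] := FP _ FY.
      by have [||?|?] := H; [right; exact: XY | right | left | right; exists Y].
    have [[_ /(_ c u v)H] _ _] := FP _ FX.
    by have [||?|?] := H; [right | right; exact: YX | left | right; exists X].
case: Lgood => -[L0 LP] Lz _; pose U x := W x \/ L x.
have Uz : ~ U z by case.
have UP c u v : U u -> U v -> U (u <* c%:A + v) by exact: LP.
have UZ c u : U u -> U (u <* c%:A) by move=> Uu; rewrite -[_ <* _]addr0; exact: UP.
have /choice[lam lamP] v : exists c, U (v - z <* c%:A).
  have [Uv|Uv] := pselect (U v); first by exists 0; rewrite scale0r /ract scale0r subr0.
  (* L' is U + k v. It is strictly larger, so by maximality it contains z; as z is not in U, the
     coefficient of v can be inverted. *)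
  pose L' : set P := fun x => exists c, U (x - v <* c%:A).
  have UL' x : U x -> L' x by move=> Ux; exists 0; rewrite scale0r /ract scale0r subr0.
  have : ~ good L'.
    apply: Lmax; split=> [x Lx|LL']; first by apply: UL'; right.
    apply: Uv; right; apply: LL'; exists 1.
    by rewrite scale1r ract1 subrr.
  have subL' : subspace (fun x => W x \/ L' x).
    have WL' x : W x \/ L' x -> L' x by case=> // Wx; apply: UL'; left.
    split=> [|c x y /WL'[c1 x1] /WL'[c2 x2]]; first by left.
    right; exists (c1 * c + c2).
    have := UP c _ _ x1 x2; congr U.
    rewrite ractDl /ract scalerN -/(ract _ _) -!/(ract _ _) ract_scal.
    by rewrite scalerDl ractDr opprD addrACA.
  move=> nL'; have [c cU] : L' z.
    by apply: contrapT => zL'; apply: nL'; split.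
  have c0 : c != 0.
    by apply/eqP => c0; apply: Uz; move: cU; rewrite c0 scale0r /ract scale0r subr0.
  exists c^-1; have := UZ (- c^-1) _ cU; congr U.
  rewrite ractDl -ractN -scaleNr !ract_scal mulrN mulNr opprK divff // scale1r ract1.
  by rewrite scaleNr ractN addrC.
have uniq_lam v c : U (v - z <* c%:A) -> lam v = c.
  move=> vc; have [//|] := eqVneq (lam v) c; rewrite -subr_eq0 => d0.
  exfalso; apply: Uz; have := UP (-1) _ _ (lamP v) vc.
  set w := _ + _; have -> : w = z <* (lam v - c)%:A.
    rewrite /w scaleN1r ractN ract1 opprB scalerBl ractDr ractN.
    by rewrite addrA subrK.
  by move=> /(UZ (lam v - c)^-1); rewrite ract_scal divff // scale1r ract1.
exists lam; split=> [c u v||w Ww].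
- apply: uniq_lam; have := UP c _ _ (lamP u) (lamP v); congr U.
  rewrite ractDl -ractN -scaleNr ract_scal mulNr.
  by rewrite addrACA scalerDl ractDr opprD scaleNr ractN.
- by apply: uniq_lam; rewrite scale1r ract1 subrr; left.
- by apply: uniq_lam; rewrite scale0r /ract scale0r subr0; left.
Qed.

End Functional.

Section Augmentation.
Variables (k : fieldType) (A : gralg k).

Fact aug_linear : linear (fun x : reg_gmod A => aug (x : A) : triv_gmod A).
Proof. by move=> a x y; rewrite augD augM. Qed.

Lemma aug_ract (x : reg_gmod A) (a : A) : aug (x <* a : A) = aug (x : A) * aug a.
Proof. exact: augM. Qed.

Definition aug_map : {linear reg_gmod A -> triv_gmod A} := mklinear aug_linear.

Lemma aug_map_deg : deg_map 0 aug_map.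
Proof.
move=> i x xi; rewrite addr0 => i0; exact: (aug_deg (xi : reg_deg i (x : A)) i0).
Qed.

Lemma aug_map_surj y : exists x, aug_map x = y.
Proof. by exists ((y : k)%:A : A); exact: aug_scal. Qed.

(** W contains the degree e part of P A_+, so a form on P_e vanishing on W, extended by 0 to the
    other degrees, is a module map P -> k[-e]. Projectivity lifts it along A[-e] -> k[-e]. *)
Lemma projective_functional (P : gmod A) (e : int) (z : P) (W : P -> Prop) :
  projective P -> gdeg e z -> subspace W -> ~ W z ->
  (forall i j x (a : A), gdeg i x -> gr j.+1 a -> i + j.+1%:Z = e -> W (x <* a)) ->
  exists G : {linear P -> reg_gmod A}, [/\ deg_map (- e) G, aug (G z : A) = 1
    & forall w, gdeg e w -> W w -> aug (G w : A) = 0].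
Proof.
move=> projP ze subW Wz Wact.
have [lam [lamP lamz lamW]] := linear_form subW Wz.
have lam0 : lam 0 = 0 by apply: lamW; case: subW.
have lamD u v : lam (u + v) = lam u + lam v.
  by have := lamP 1 u v; rewrite scale1r ract1 mulr1.
have lamZ c u : lam (u <* c%:A) = lam u * c by have := lamP c u 0; rewrite lam0 !addr0.
pose ell x := lam (component e x).
have ellD u v : ell (u + v) = ell u + ell v by rewrite /ell /component dprojD lamD.
have ell0 : ell 0 = 0 by rewrite /ell /component dproj0 lam0.
have ell_hom i j x (a : A) : gdeg i x -> gr j a -> ell (x <* a) = ell x * aug a.
  move=> xi; case: j => [/gr_connected[c ->]|j aj].
    rewrite aug_scal /ell (component_hom _ xi).
    have /component_hom-> : gdeg i (x <* c%:A).
      by rewrite -[i]addr0; apply: gdeg_actZ => //; exact: reg_deg1.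
    by case: ifP => _; rewrite ?lamZ // lam0 mul0r.
  rewrite (aug_hom aj) mulr0 /ell (component_hom _ (gdeg_act xi aj)).
  case: eqP => // ije; rewrite ?lam0 //; apply: lamW; exact: (Wact i j).
have ell_act x (a : A) : ell (x <* a) = ell x * aug a.
  have [s xs] := component_sum x; rewrite xs.
  have [_ /(_ a)[t [f [fP ->]]] _] := gr_direct A.
  elim/big_rec: _ => [|i u _ IHu]; first by rewrite ract0 ell0 mul0r.
  rewrite ractDl !ellD mulrDl IHu; congr (_ + _).
  elim/big_rec: _ => [|j b _ IHb].
    by rewrite aug0 mulr0 /ract scale0r ell0.
  rewrite ractDr augD ellD mulrDr IHb; congr (_ + _).
  exact: (ell_hom i j) (component_in _ _) (fP j).
have ell_lin : linear (fun x : P => ell x : shift_gmod (triv_gmod A) (- e)).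
  by move=> a x y; rewrite ellD; congr (_ + _); exact: ell_act.
have [| | G Gd GE] := projP (shift_gmod (reg_gmod A) (- e))
    (shift_gmod (triv_gmod A) (- e)) aug_map
    (mklinear ell_lin) _ aug_map_surj.
- move=> i x xi; have := aug_map_deg (xi : gdeg (i - e) (x : reg_gmod A)).
  by rewrite !addr0; exact.
- move=> i x xi; rewrite /= /shift_deg addr0 => ie.
  rewrite /ell (component_hom _ xi) ifN ?lam0 //.
  by apply: contra ie => /eqP->; rewrite subrr.
exists G; split.
- by move=> i x xi; have := Gd _ _ xi; rewrite addr0.
- by rewrite [LHS]GE /= /ell (component_hom _ ze) eqxx.
- by move=> w we Ww; rewrite [LHS]GE /= /ell (component_hom _ we) eqxx lamW.
Qed.

End Augmentation.

Section MinimalGenerators.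
Variables (k : fieldType) (A : gralg k).

Definition generates_Aplus n (d : 'I_n -> nat) (x : 'I_n -> A) :=
  (forall i, (0 < d i)%N /\ gr (d i) (x i)) /\
  forall a, aug a = 0 -> exists b : 'I_n -> A, a = \sum_i x i * b i.

Lemma Aplus_homogeneous : homogeneous (@Aplus k A).
Proof.
move=> x [n [f [fP ->]]].
exists (map S (iota 0 n)), (fun i => if i is j.+1 then f j else 0); split.
  by case=> [|i]; split; [exact: gr0 | exact: Aplus0 | | exact: Aplus_hom (fP i)].
by rewrite big_map -[X in iota 0 X]subn0 -/(index_iota 0 n) big_mkord.
Qed.

Lemma Aplus_generators : exists n (d : 'I_n -> nat) (x : 'I_n -> A),
  generates_Aplus d x.
Proof.
have [s sP] := gr_fingen A.
have [|n [d [x [xP xE]]]] := @homogeneous_generators k A (@Aplus k A) (size s)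
  (fun j => s`_j - (aug s`_j)%:A) Aplus_homogeneous; first by move=> j; exact: augP.
(* A generator of degree 0 in A_+ is 0, so it may be given degree 1. *)
exists n, (fun i => if d i == 0%N then 1%N else d i), x; split.
  move=> i; have [xi Ai] := xP i; case: eqP => [d0|/eqP]; last by rewrite -lt0n.
  move: xi; rewrite d0 => /gr_connected[c xc]; split=> //.
  by move: Ai; rewrite xc => /Aplus_scalar->; rewrite scale0r; exact: gr0.
(* The set k + sum_i x_i A contains the algebra generators and is closed under products, so it is
   all of A. *)
suff H a : exists c (b : 'I_n -> A), a = c%:A + \sum_i x i * b i.
  move=> a a0; have [c [b aE]] := H a; exists b.
  suff c0 : c = 0 by rewrite {1}aE c0 scale0r add0r.
  rewrite -a0 aE augD aug_scal aug_sum big1 ?addr0 // => i _.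
  have [_ Ai] := xP i; rewrite augM (_ : aug (x i) = 0) ?mul0r //.
  by apply: augE; rewrite scale0r subr0.
move: a; apply: sP.
- by exists 1, (fun=> 0); rewrite scale1r big1 ?addr0 // => i _; rewrite mulr0.
- move=> z _ _ [c [b ->]] [c' [b' ->]].
  exists (z * c + c'), (fun i => z *: b i + b' i).
  rewrite scalerDr scalerDl addrACA scalerA; congr (_ + _).
  rewrite scaler_sumr -big_split; apply: eq_bigr => i _ /=.
  by rewrite mulrDr scalerAr.
- move=> _ _ [c [b ->]] [c' [b' ->]].
  exists (c * c'), (fun i => b i * (c'%:A + \sum_j x j * b' j) + c *: b' i).
  rewrite mulrDl mulrDr mulr_algl scalerA -addrA; congr (_ + _).
  under [RHS]eq_bigr do rewrite mulrDr.
  rewrite big_split addrC; congr (_ + _).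
    by rewrite mulr_suml; apply: eq_bigr => i _; rewrite mulrA.
  by rewrite mulr_algl scaler_sumr; apply: eq_bigr => i _; rewrite scalerAr.
- move=> z zs; have zi : (index z s < size s)%N by rewrite index_mem.
  have [b bE] := xE (Ordinal zi); exists (aug z), b.
  by rewrite -bE /= nth_index // addrC subrK.
Qed.

(* Minimality of the number of generators forces the syzygies into A_+. *)
Lemma minimal_Aplus_generators : exists n (d : 'I_n -> nat) (x : 'I_n -> A),
  generates_Aplus d x /\
  forall (e : int) (b : 'I_n -> A), (forall i, reg_deg (e - (d i)%:Z) (b i)) ->
    \sum_i x i * b i = 0 -> forall i, aug (b i) = 0.
Proof.
pose P n := `[< exists (d : 'I_n -> nat) (x : 'I_n -> A), generates_Aplus d x >].
have exP : exists n, P n.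
  by have [n H] := Aplus_generators; exists n; exact/asboolP.
case: (ex_minnP exP) => -[|n] /asboolP[d [x [dx xgen]]] nmin.
  by exists 0%N, d, x; split=> // e b _ _ [].
exists n.+1, d, x; split=> // e b b_deg xb i; apply/eqP/negPn/negP => bi0.
have ei : e - (d i)%:Z = 0.
  by apply/eqP; apply: contraNT bi0 => /(aug_deg (b_deg i))->.
have [c bc] : exists c : k, b i = c%:A.
  by apply: reg_deg0P; rewrite -ei.
have c0 : c != 0 by move: bi0; rewrite bc aug_scal.
suff /nmin : P n by rewrite ltnn.
apply/asboolP; exists (d \o lift i), (x \o lift i); split=> [j|a a0].
  exact: dx.
have [b' ->] := xgen a a0.
exists (fun j => b' (lift i j) - c^-1 *: (b (lift i j) * b' i)).
under [RHS]eq_bigr do rewrite mulrBr -scalerAr mulrA.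
rewrite sumrB -scaler_sumr -mulr_suml (bigD1_ord i) //= [LHS]addrC; congr (_ + _).
move: xb; rewrite (bigD1_ord i) //= => /eqP; rewrite addrC addr_eq0 => /eqP->.
by rewrite bc mulr_algr mulNr scalerN opprK -scalerAl scalerA mulVf // scale1r.
Qed.

End MinimalGenerators.

(** * The second syzygy of k over a regular algebra of dimension 2 *)

Section RegularDim2.
Variables (k : fieldType) (A : gralg k).
Hypothesis regA : regular A 2.
Variables (n : nat) (d : 'I_n -> nat) (x : 'I_n -> A).
Hypothesis genx : generates_Aplus d x.
Hypothesis irredundant : forall (e : int) (b : 'I_n -> A),
  (forall i, reg_deg (e - (d i)%:Z) (b i)) ->
  \sum_i x i * b i = 0 -> forall i, aug (b i) = 0.

Let dz (i : 'I_n) : int := (d i)%:Z.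
Let F := free_gmod A dz.
Let x_hom (i : 'I_n) : gdeg (dz i) (x i : reg_gmod A).
Proof. by have [/(_ i)[]] := genx. Qed.

Lemma relations_map : exists2 del : {linear F -> reg_gmod A}, deg_map 0 del &
  forall b : F, del b = \sum_i x i * (b : {ffun _ -> _}) i :> A.
Proof.
have [del dd dE] := free_map_ex x_hom.
by exists del.
Qed.

Variables (del : {linear F -> reg_gmod A}) (del_deg : deg_map 0 del).
Hypothesis delE : forall b : F, del b = \sum_i x i * (b : {ffun _ -> _}) i :> A.

Let K := ker_gmod del_deg.
Let inc : {linear K -> F} := ker_incl del_deg.

Let aug_x i : aug (x i) = 0.
Proof.
apply: (aug_deg (x_hom i)); rewrite eqz_nat -lt0n.
by have [/(_ i)[]] := genx.
Qed.

Let del_aug b : aug_map A (del b) = 0.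
Proof.
rewrite /= delE aug_sum big1 // => i _.
by rewrite augM aug_x mul0r.
Qed.

Let exact_del a : aug_map A a = 0 <-> exists b, a = del b.
Proof.
split=> [a0|[b ->]]; last exact: del_aug.
have [_ /(_ a a0)[b ->]] := genx; exists [ffun i => b i].
by rewrite delE; apply: eq_bigr => i _; rewrite ffunE.
Qed.

Let projK : projective K.
Proof.
have [[pdA _] _ _] := regA.
apply: (second_syzygy_projective (eps := aug_map A)) (pdA (triv_gmod A)).
- exact: reg_projective.
- exact: free_projective.
- exact: aug_map_deg.
- exact: aug_map_surj.
- exact: del_aug.
- by move=> a /exact_del[b ->]; exists b.
Qed.

Lemma K_aug e (b : K) i : gdeg e b -> aug (inc b i : A) = 0.
Proof.
move=> b_deg; apply: (irredundant (b := fun i => inc b i)) => [j|].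
  exact: b_deg.
by have := f_ker_incl b; rewrite delE.
Qed.

Lemma free_mapE (g : {linear F -> reg_gmod A}) (b : F) :
  g b = \sum_i (g (free_gen A dz i) : A) * (b i : A) :> A.
Proof.
rewrite {1}(free_genE b) linear_sum.
by apply: eq_bigr => i _; rewrite ract_linear.
Qed.

(** By minimality the elements of K have coordinates in A_+, and a map on F is left multiplication
    of the coordinates by constants of A. *)
Lemma extends_aug j (f : K -> reg_gmod A) e b :
  extends j f -> gdeg e b -> aug (f b : A) = 0.
Proof.
move=> [g gd fE] be; rewrite fE free_mapE aug_sum big1 // => i _.
by rewrite augM (K_aug _ be) mulr0.
Qed.

Lemma K_nonneg e (b : K) : gdeg e b -> e < 0 -> b = 0.
Proof.
move=> be e0; apply: (@ker_incl_inj _ _ _ _ _ del_deg); apply/ffunP => i.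
rewrite linear0 ffunE; apply: (reg_deg_neg (i := e - (d i)%:Z)); last exact: be.
by lia.
Qed.

Let ext_aug l : Ext_iso 2 (triv_gmod A) (reg_gmod A) (shift_k k l) ->
  forall j (f : {linear K -> reg_gmod A}) e b, deg_map j f -> l + j <> 0 ->
  gdeg e b -> aug (f b : A) = 0.
Proof.
move=> Ext2 j f e b fj lj be.
have H := Ext2_shift_vanish (@reg_projective k A) (@free_projective k A n dz) projK
  (@aug_map_deg k A) (@aug_map_surj k A) exact_del Ext2 fj lj.
exact: extends_aug H be.
Qed.

(* By projectivity, two generators of K would give functionals K -> A that are
   independent modulo A_+, while maps that extend to F take values in A_+. *)
Lemma K_cyclic : exists (l : int) (z : K),
  [/\ Ext_iso 2 (triv_gmod A) (reg_gmod A) (shift_k k l), gdeg l z, z <> 0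
    & forall e b, gdeg e b -> exists2 a : A, reg_deg (e - l) a & b = z <* a].
Proof.
have [_ _ [l Ext2]] := regA; exists l.
have [b b0] := Ext2_shift_nonzero (@reg_projective k A) (@free_projective k A n dz) projK
  (@aug_map_deg k A) (@aug_map_surj k A) exact_del Ext2.
(* The generator z is sought in the lowest degree N where K is nonzero; there K A_+ vanishes, so W =
   0 is allowed for G1. *)
pose P N := `[< exists2 z : K, gdeg N%:Z z & z <> 0 >].
have exP : exists N, P N.
  apply: contrapT => nP; apply: b0.
  have [s ->] := component_sum b.
  rewrite big1 // => e _; apply: contrapT => e0; apply: nP.
  have be : gdeg e (component e b) by exact: component_in.
  case: e e0 be => N e0 be; first by exists N; apply/asboolP; exists (component N b).
  by case: e0; exact: K_nonneg be _.
case: (ex_minnP exP) => N /asboolP[z zN z0] Nmin; exists z.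
have low e b' : gdeg e b' -> e < N%:Z -> b' = 0 :> K.
  case: e => e be eN; last exact: K_nonneg be _.
  apply: contrapT => b'0; suff /Nmin : P e by lia.
  by apply/asboolP; exists b'.
have [|||G1 [G1d G1z _]] := projective_functional (P := K) (e := N) (z := z)
  (W := fun w => w = 0) projK zN.
- by split=> // c u v -> ->; rewrite ract0 addr0.
- by [].
- by move=> i j u a ui _ ij; rewrite (low i u ui) ?ract0 //; lia.
(* G1 takes the value 1 modulo A_+ at z, so it does not extend to F; by the Gorenstein condition its
   degree -N is then -l. *)
have Nl : N%:Z = l.
  apply: contrapT => Nl; have := ext_aug Ext2 G1d _ zN; rewrite G1z => H.
  by have /eqP := H ltac:(lia); rewrite oner_eq0.
rewrite Nl in zN low G1d; split=> // e.
have [M] : exists M : nat, e < M%:Z by exists `|e|.+1%N; lia.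
elim: M e => [|M IH] e eM b' be.
  exists 0; first exact: reg_deg0.
  by rewrite /ract scale0r; exact: K_nonneg be eM.
apply: contrapT => nb'.
have [|||G2 [G2d G2b G2W]] := projective_functional (P := K) (e := e) (z := b')
  (W := fun w => exists2 a : A, reg_deg (e - l) a & w = z <* a) projK be.
- split; first by exists 0; [exact: reg_deg0 | rewrite /ract scale0r].
  move=> c _ _ [a1 a1d ->] [a2 a2d ->]; exists (c *: a1 + a2).
    by apply: reg_degD => //; exact: reg_degZ.
  by rewrite ractA mulr_algr ractDr.
- exact: nb'.
- move=> i j u a ui aj ij; have [|a' a'd ->] := IH i _ u ui; first by lia.
  exists (a' * a); last by rewrite ractA.
  have -> : e - l = i - l + j.+1%:Z by lia.
  exact: (reg_degM a'd (aj : reg_deg j.+1 a)).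
have [el|el] := eqVneq e l; last first.
  have := ext_aug Ext2 G2d _ be; rewrite G2b => H.
  by have /eqP := H ltac:(lia); rewrite oner_eq0.
rewrite el in G2d be G2W.
have nG1 : ~ extends (- l) G1.
  by move=> /extends_aug/(_ zN)/eqP; rewrite G1z oner_eq0.
have [c cP] := Ext2_shift_line (@reg_projective k A) (@free_projective k A n dz) projK
  (@aug_map_deg k A) (@aug_map_surj k A) exact_del Ext2 G1d G2d nG1.
have lh : linear (fun u : K => G1 u <* c%:A + G2 u).
  move=> a u v; rewrite !linearP /= (ractDl (M := reg_gmod A)) scalerDr addrACA.
  congr (_ + _ + _); rewrite /ract !scalerA; congr (_ *: _).
  exact: (etrans (mulr_algr c (a : A)) (esym (mulr_algl c (a : A)))).
have hd : deg_map (- l) (mklinear lh).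
  move=> i u ui; apply: gdegD; last exact: G2d.
  by rewrite -[_ - l]addr0; apply: gdeg_actZ; [exact: G1d | exact: reg_deg1].
(* The map c G1 + G2 extends to F, so it vanishes modulo A_+. At z this gives c = 0, and then at b'
   it gives 1 = 0. *)
have hE e' u : gdeg e' u -> aug (G1 u : A) * c + aug (G2 u : A) = 0.
  move=> ue; have := extends_aug (cP _ hd (fun=> erefl)) ue.
  by rewrite augD aug_ract aug_scal.
have := hE _ _ zN; rewrite G1z mul1r G2W //; last first.
  by exists 1; rewrite ?ract1 // subrr -[1]scale1r; exact: reg_deg1.
rewrite addr0 => c0; have := hE _ _ be.
by rewrite c0 mulr0 add0r G2b => /eqP; rewrite oner_eq0.
Qed.

(** The surjection a |-> z a from A[-l] onto K splits by projectivity. Its section s sends z to a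
    scalar c with z (c - 1) = 0, so c = 1 and K is free on z; the y_i are the coordinates of z in
    F. *)
Lemma dim2_data_of_syzygies : exists (l : int) (y : 'I_n -> A),
  dim2_data d l x y /\ (1 < n)%N.
Proof.
have [l [z [Ext2 zl z0 zgen]]] := K_cyclic.
have lp : linear (fun a : shift_gmod (reg_gmod A) (- l) => z <* (a : A)).
  by move=> a u v; rewrite ractDr; congr (_ + _); rewrite -ractA.
have pd : deg_map 0 (mklinear lp).
  move=> i a ai; have -> : i + 0 = l + (i - l) by lia.
  exact: gdeg_actZ.
have ps b : exists a, mklinear lp a = b.
  have [s ->] := component_sum b.
  elim/big_rec: _ => [|i u _ [a aE]]; first by exists 0; rewrite linear0.
  have [a' _ a'E] := zgen i _ (component_in i b).
  by exists (a' + a); rewrite linearD aE; congr (_ + _); rewrite -[LHS]a'E.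
have [s sd sE] := projK pd ps (@deg_map_id k A K).
have sz : s z = 1 :> A.
  have : reg_deg 0 (s z : A) by have := sd _ _ zl; rewrite /= /shift_deg addr0 subrr.
  move=> /reg_deg0P[c sc]; suff c1 : c = 1 by rewrite sc c1 scale1r.
  apply/eqP; rewrite -subr_eq0; apply: contra_notT z0 => c1.
  have zc : z <* (c - 1)%:A = 0.
    by rewrite scalerBl scale1r ractDr ractN ract1 -sc [X in X - _]sE subrr.
  by rewrite -[z]ract1 -(scale1r 1) -(divff c1) -ract_scal zc ract0.
have s_act a : s (z <* a) = a :> A.
  by rewrite ract_linear [s z]sz; exact: mul1r.
pose y i : A := inc z i.
have y_deg i : reg_deg (l - (d i)%:Z) (y i) by exact: zl.
have xy : \sum_i x i * y i = 0 by have := f_ker_incl z; rewrite delE.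
exists l, y.
have D : dim2_data d l x y.
  split=> //.
  - by move=> i; have [/(_ i)[]] := genx.
  - move=> e a ae.
    have [|b be bE] := deg_map_surj del_deg _ (ae : gdeg e.+1%:Z (a : reg_gmod A)).
      have /exact_del[b ->] : aug_map A a = 0 by exact: aug_hom ae.
      by exists b.
    by exists (fun i => b i) => //; rewrite -delE.
  - move=> e b bd xb.
    have [|kb kbE] := @ker_inclP _ _ _ _ _ del_deg [ffun i => b i : (galg A)^c^o].
      by rewrite delE -[RHS]xb; apply: eq_bigr => i _; rewrite ffunE.
    have bE i : b i = inc kb i by rewrite [inc kb]kbE ffunE.
    have [|w wd wE] := zgen e kb; first by move=> i; have := bd i; rewrite bE.
    by exists w => // i; rewrite bE wE ract_linear ffunE.
  - move=> e a ae.
    (* The map u |-> a s(u) sends z to a and has degree other than -l, so it extends to g on F;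
       evaluating g at z writes a as a left combination of the y_i. *)
    have lf : linear (fun u : K => (a * (s u : A)) : reg_gmod A).
      move=> a' u v; rewrite linearP /= mulrDr; congr (_ + _).
      exact: (mulrA a (s u : A) (a' : A)).
    have fd : deg_map (e.+1%:Z - l) (mklinear lf).
      move=> i u ui; have -> : i + (e.+1%:Z - l) = e.+1%:Z + (i - l) by lia.
      apply: (reg_degM (ae : reg_deg e.+1 a)).
      by have := sd _ _ ui; rewrite addr0.
    have [|g gd gE] := Ext2_shift_vanish (@reg_projective k A) (@free_projective k A n dz) projK
      (@aug_map_deg k A) (@aug_map_surj k A) exact_del Ext2 fd; first by lia.
    exists (fun i => g (free_gen A dz i) : A) => [i|].
      have := gd _ _ (@free_gen_deg k A n dz i).
      by have -> : dz i + (e.+1%:Z - l) = e.+1%:Z - (l - (d i)%:Z) by rewrite /dz; lia.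
    by have := gE z; rewrite /= sz mulr1 free_mapE.
split=> //.
have [i yi0] : exists i, y i <> 0.
  apply: contrapT => ny; apply: z0; apply: (@ker_incl_inj _ _ _ _ _ del_deg).
  rewrite linear0; apply/ffunP => i; rewrite [RHS]ffunE.
  by apply: contrapT => yi; apply: ny; exists i.
(* With one generator, x and y are multiples of each other, and degrees force the factors to be
   scalars. Then x y = 0 implies y x = 0, so z x = 0, against freeness of K on z. *)
rewrite ltnNge; apply/negP => n1.
have sum1 (G : 'I_n -> A) : \sum_j G j = G i.
  rewrite (bigD1 i) //= big1 ?addr0 // => j /negP ji; case: ji; apply/eqP/val_inj.
  by rewrite /=; have := ltn_ord i; have := ltn_ord j; lia.
have [c c_deg yc] : exists2 c, reg_deg (l - (d i)%:Z - (d i)%:Z) c & y i = x i * c.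
  case E : (l - (d i)%:Z) (y_deg i) => [[|e]|e] ye; last by case: yi0; exact: ye.
    have [c yE] := reg_deg0P ye; case: yi0.
    by rewrite yE -(aug_scal A c) -yE (K_aug i zl) scale0r.
  have [c cd yE] := x_gen D ye; exists (c i); first exact: cd.
  by rewrite yE sum1.
have [b b_deg xb] : exists2 b, reg_deg ((d i)%:Z - (l - (d i)%:Z)) b & x i = b * y i.
  have := x_deg D i; case E : (d i) (d_gt0 D i) => [//|e] _ xe.
  have [b bd xE] := y_gen D xe; exists (b i); last by rewrite xE sum1.
  by have := bd i; rewrite E.
have xi0 : x i <> 0 by move=> xi0; apply: yi0; rewrite yc xi0 mul0r.
have l2d : l = (d i)%:Z + (d i)%:Z.
  have [ld|] := ltP (l - (d i)%:Z - (d i)%:Z) 0.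
    by case: yi0; rewrite yc (reg_deg_neg ld c_deg) mulr0.
  have [dl|] := ltP ((d i)%:Z - (l - (d i)%:Z)) 0; last by lia.
  by case: xi0; rewrite xb (reg_deg_neg dl b_deg) mul0r.
have [be bE] : exists be : k, b = be%:A.
  by apply: reg_deg0P; move: b_deg; rewrite l2d addrK subrr.
have [ga cE] : exists ga : k, c = ga%:A.
  by apply: reg_deg0P; move: c_deg; rewrite l2d addrK subrr.
have xy0i : x i * y i = 0 by move: xy; rewrite sum1.
apply: xi0; rewrite -(s_act (x i)) (_ : z <* x i = 0) ?linear0 //.
apply: (@ker_incl_inj _ _ _ _ _ del_deg); apply/ffunP => j.
rewrite ract_linear linear0 [RHS]ffunE ffunE.
have -> : j = i by apply: val_inj => /=; have := ltn_ord i; have := ltn_ord j; lia.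
suff : y i * x i = 0 by [].
rewrite xb bE mulr_algl -scalerAr {1}yc cE mulr_algr -scalerAl xy0i.
by rewrite !scaler0.
Qed.

End RegularDim2.

Theorem theorem1p4 (k : fieldType) (A : gralg k) :
  regular A 2 -> graded_coherent A.
Proof.
move=> regA; have [n [d [x [genx irr]]]] := minimal_Aplus_generators A.
have [del del_deg delE] := relations_map genx.
have [l [y [D n1]]] := dim2_data_of_syzygies regA genx irr del_deg delE.
exact: coherent_of_dim2_data D n1.
Qed.
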